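(* Let a function $f$ be analytic on an open disc of radius $\rho>0$ centered at a point $z_0\in\mathbb C$, and let the spectrum $\sigma(A)$ of a square complex matrix $A\in\mathbb C^{n\times n}$ be contained in this disc. Let $r=\frac uv$ be the Padé approximant of degree $[L/M]$ of $f$ at the point $z_0$, and assume that $v(\lambda)\neq0$ for all $\lambda\in\sigma(A)$. Put $N=L+M+1$. Then, for any norm on $\mathbb C^{n\times n}$, $$\bigl\Vert f(A)-r(A)\bigr\Vert\le\max_{t\in[0,1]}\Bigl\lVert (A-z_0\mathbf 1)^N[v(A)]^{-1}\frac{(vf)^{(N)}\bigl((1-t)z_0\mathbf 1+tA\bigr)}{N!}\Bigr\rVert.$$
   Context: $\mathbf 1$ is the identity matrix. If $g$ is analytic on an open set containing $\sigma(B)$, then $g(B)=\frac1{2\pi i}\int_\Gamma g(\lambda)(\lambda\mathbf 1-B)^{-1}d\lambda$, where the contour $\Gamma$ encloses $\sigma(B)$; $(vf)^{(N)}$ is the $N$-th complex derivative of $vf$. The Padé approximant of degree $[L/M]$ of $f$ at $z_0$ is the rational function $r=u/v$, with polynomials $\deg u\le L$, $\deg v\le M$, $v(z_0)\ne0$, that interpolates $f$ at the single point $z_0$ with multiplicity $N=L+M+1$, i.e. $r^{(j)}(z_0)=f^{(j)}(z_0)$ for $j=0,1,\dots,N-1$ (its existence is presupposed). *)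

(* Defs.v *)
From HB Require Import structures.
From mathcomp Require Import all_boot all_order all_algebra.
From mathcomp Require Import complex.
From mathcomp Require Import all_classical all_reals all_analysis.

Set Implicit Arguments.
Unset Strict Implicit.
Unset Printing Implicit Defensive.

Import Order.TTheory GRing.Theory Num.Theory.
Import numFieldNormedType.Exports.

Local Open Scope classical_set_scope.
Local Open Scope ring_scope.
Local Open Scope complex_scope.

(* [R[i]] carries its field topology, as a normed module over itself. *)
#[export, non_forgetful_inheritance]
HB.instance Definition _ (R : rcfType) := NormedModule.copy R[i] R[i]^o.

Section Functions.
Context {R : realType}.
Local Notation C := R[i].
Implicit Types (U : set C) (z : C).

Definition disc z (rho : R) : set C := [set w | `|w - z| < rho%:C].

(* Analyticity: local representation by a convergent power series. *)
Definition analytic_on U (g : C -> C) := forall w, U w ->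
  exists2 r : R, 0 < r & exists a : nat -> C,
    forall z, disc w r z -> series (fun k => a k * (z - w) ^+ k) @ \oo --> g z.

Record is_pade (L M : nat) (f : C -> C) (z0 : C) (u v : {poly C}) : Prop := {
  pade_num : (size u <= L.+1)%N ;
  pade_den : (size v <= M.+1)%N ;
  pade_den_neq0 : v.[z0] != 0 ;
  pade_interp : forall j, (j < L + M + 1)%N ->
    derive1n j (fun z => u.[z] / v.[z]) z0 = derive1n j f z0 }.

(* An arc is a map on [0, 1]; it is written as the restriction of a function on
   the whole line, so that derivatives at 0 and 1 need no special treatment
   (every C^1 map on [0, 1] extends to a C^1 map on the line). *)
Definition C1_arc (g : R -> C) : Prop :=
  [/\ forall t, derivable (fun s => complex.Re (g s)) t 1,
      forall t, derivable (fun s => complex.Im (g s)) t 1,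
      continuous (derive1 (fun s => complex.Re (g s))) &
      continuous (derive1 (fun s => complex.Im (g s)))].

Definition velocity (g : R -> C) (t : R) : C :=
  derive1 (fun s => complex.Re (g s)) t +i* derive1 (fun s => complex.Im (g s)) t.

(* A closed piecewise C^1 path is a list of C^1 arcs, each ending where the next
   one (cyclically) begins; a contour is a finite family of such paths. *)
Definition closed_path (p : seq (R -> C)) : Prop :=
  cycle (fun g h => g 1 == h 0) p /\ forall g, g \in p -> C1_arc g.

Definition contour (G : seq (seq (R -> C))) : Prop :=
  forall p, p \in G -> closed_path p.

Definition support_of (G : seq (seq (R -> C))) : set C :=
  [set z | exists2 g, g \in flatten G &
             exists2 t : R, 0 <= t <= 1 & z = g t].

Definition arc_integral (g : R -> C) (h : C -> C) : C :=
  (\int[lebesgue_measure]_(t in `[0, 1]) complex.Re (h (g t) * velocity g t))%R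
  +i*
  (\int[lebesgue_measure]_(t in `[0, 1]) complex.Im (h (g t) * velocity g t))%R.

Definition contour_integral (G : seq (seq (R -> C))) (h : C -> C) : C :=
  \sum_(g <- flatten G) arc_integral g h.

Definition twopii : C := 0 +i* (2 * pi).

Definition winding (G : seq (seq (R -> C))) (a : C) : C :=
  twopii^-1 * contour_integral G (fun z => (z - a)^-1).

(* [G] encloses [K] within [U]: the contour lies in [U] minus [K], turns once
   around every point of [K], and does not turn around any point outside [U]. *)
Definition encloses (G : seq (seq (R -> C))) (K U : set C) : Prop :=
  [/\ contour G, support_of G `<=` U `\` K,
      forall a, K a -> winding G a = 1 &
      forall a, ~ U a -> winding G a = 0].

End Functions.

Section MatrixFunctions.
Context {R : realType} {n : nat}.
Local Notation C := R[i].
Implicit Types (U : set C) (g : C -> C) (B : 'M[C]_n).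

Definition spectrum B : set C := [set z | eigenvalue B z].

Definition resolvent_integral G g B : 'M[C]_n :=
  twopii^-1 *:
    \matrix_(i, j) contour_integral G (fun z => g z * invmx (z%:M - B) i j).

(* [g(B)] for [g] analytic on the open set [U] containing the spectrum of [B];
   the value is then the same for all contours enclosing the spectrum in [U]. *)
Definition matfun U g B : 'M[C]_n :=
  xget 0 [set F | exists2 G, encloses G (spectrum B) U &
                             F = resolvent_integral G g B].

Record is_norm (nrm : 'M[C]_n -> R) : Prop := {
  nrm_eq0 : forall X, nrm X = 0 -> X = 0 ;
  nrm_triangle : forall X Y, nrm (X + Y) <= nrm X + nrm Y ;
  nrm_scale : forall (c : C) X, (nrm (c *: X))%:C = `|c| * (nrm X)%:C }.

End MatrixFunctions.

(* Main.v *)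
Require Import Defs.
From HB Require Import structures.
From mathcomp Require Import all_boot all_order all_algebra.
From mathcomp Require Import complex.
From mathcomp Require Import all_classical all_reals all_analysis.
From mathcomp Require Import ring lra.

(** The estimate is Taylor's formula with remainder, along the segment from
    z0 to A. Put H = v f - u, X = A - z0 and B_t = (1 - t) z0 + t A. Since
    u / v interpolates f to order N at z0 and v(z0) is not 0, the product
    H = v (f - u / v) vanishes to order N at z0 (pade_error_vanishes); since
    u has degree less than N, H and v f have the same N-th derivative. The
    matrix
      Y(t) = \sum_(j < N) (1 - t)^j / j! X^j H^(j)(B_t)
    has a telescoping derivative,
      Y'(t) = (1 - t)^(N-1) / (N-1)! X^N H^(N)(B_t)   (taylor_mx_deriv),
    with Y(0) = 0 and Y(1) = H(A) = v(A) (f(A) - r(A)). After multiplication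
    by v(A)^-1, the derivative is N (1 - t)^(N-1) times the matrix on the
    right-hand side of the estimate, and a mean value inequality, valid for
    any norm, compares v(A)^-1 Y(t) with - K (1 - t)^N, where K is the
    maximum (nrm_mean_value).

    This rests on a calculus for g(B), which is defined by contour integrals
    over any enclosing family of closed paths. All evaluations come from
    resolvent_integral_poly: if g = p + chi h on U, with chi the
    characteristic polynomial of B, p a polynomial, and h times any
    polynomial of integral 0, then g(B) = p(B). Indeed chi(z) (z - B)^-1 is
    polynomial in z, and for polynomials the Newton expansion of the
    resolvent along the eigenvalues s_1, s_2, ... leaves the integrals of
    1 / ((z - s_1) ... (z - s_k)), which are computed by partial fractions
    (contour_integral_inv_prod). For u / v such a decomposition is a Bezout
    identity between v and chi. For a function on a disc it comes from
    dividing successively by z - s_i (smooth_divide), and the integral of h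
    is 0 because h has a primitive there (smooth_primitive).

    Division and primitives on a disc both follow from one fact: the means
    of g over the segments from a to z, with weights t^k, are complex
    differentiable in z, by differentiation under the integral sign
    (cint_parametric_derivative). The class of functions on which this can
    be iterated is that of infinitely differentiable functions of a complex
    variable; locally convergent power series belong to it by termwise
    differentiation (power_series_derivative). The same parametric
    differentiation, applied to g(z0 + t (z - z0)) on a fixed contour around
    the spectrum of A, gives the derivative of g(B_t). *)

Set Implicit Arguments.
Unset Strict Implicit.
Unset Printing Implicit Defensive.

Import Order.TTheory GRing.Theory Num.Theory.
Import numFieldNormedType.Exports.

Local Open Scope classical_set_scope.
Local Open Scope ring_scope.
Local Open Scope complex_scope.

(** * Modulus and limits of complex numbers *)

(** The modulus as a real number; `|z| lies in R[i]. *)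
Definition cabs {R : rcfType} (z : R[i]) : R := Normc.normc z.
Arguments cabs : simpl never.

Section Complex.
Context {R : realType}.
Local Notation C := R[i].

Lemma cabsE (z : C) : `|z| = (cabs z)%:C.
Proof. by []. Qed.

Lemma cabs_def (z : C) :
  cabs z = Num.sqrt (complex.Re z ^+ 2 + complex.Im z ^+ 2).
Proof. by case: z. Qed.

Lemma cabs_ge0 (z : C) : 0 <= cabs z.
Proof. by rewrite cabs_def sqrtr_ge0. Qed.

Lemma cabsM (z w : C) : cabs (z * w) = cabs z * cabs w.
Proof. exact: Normc.normcM. Qed.

Lemma cabsD (z w : C) : cabs (z + w) <= cabs z + cabs w.
Proof. exact: le_normcD. Qed.

Lemma cabsN (z : C) : cabs (- z) = cabs z.
Proof. exact: normcN. Qed.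

Lemma cabsB (z w : C) : cabs (z - w) = cabs (w - z).
Proof. by rewrite -cabsN opprB. Qed.

Lemma cabs0 : cabs (0 : C) = 0.
Proof. exact: Normc.normc0. Qed.

Lemma cabs1 : cabs (1 : C) = 1.
Proof. exact: Normc.normc1. Qed.

Lemma cabsV (z : C) : cabs z^-1 = (cabs z)^-1.
Proof. exact: Normc.normcV. Qed.

Lemma cabsX (z : C) k : cabs (z ^+ k) = cabs z ^+ k.
Proof. by elim: k => [|k IH]; rewrite ?cabs1// !exprS cabsM IH. Qed.

Lemma cabs_eq0 (z : C) : (cabs z == 0) = (z == 0).
Proof.
by apply/eqP/eqP => [/Normc.eq0_normc//|->]; exact: cabs0.
Qed.

Lemma cabs_gt0 (z : C) : (0 < cabs z) = (z != 0).
Proof. by rewrite lt_def cabs_eq0 cabs_ge0 andbT. Qed.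

Lemma cabsR (x : R) : cabs x%:C = `|x|.
Proof. by rewrite cabs_def /= expr0n addr0 sqrtr_sqr. Qed.

Lemma cabsn (k : nat) : cabs (k%:R : C) = k%:R.
Proof.
by rewrite -(rmorph_nat (real_complex R)) cabsR ger0_norm.
Qed.

Lemma absRe (z : C) : `|complex.Re z| <= cabs z.
Proof. by rewrite -lecR -cabsE normc_ge_Re. Qed.

Lemma absIm (z : C) : `|complex.Im z| <= cabs z.
Proof.
by rewrite cabs_def -[X in X <= _]sqrtr_sqr ler_wsqrtr// lerDr sqr_ge0.
Qed.

Lemma cabs_ReIm (z : C) : cabs z <= `|complex.Re z| + `|complex.Im z|.
Proof.
case: z => x y; rewrite {1}[x +i* y]complexE.
apply: (le_trans (cabsD _ _)); rewrite cabsM !cabsR lerD2l.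
by rewrite cabs_def /= expr0n add0r expr1n sqrtr1 mul1r.
Qed.

Lemma cabs_sum (n : nat) (F : 'I_n -> C) :
  cabs (\sum_(k < n) F k) <= \sum_(k < n) cabs (F k).
Proof.
elim/big_ind2: _ => [|x1 y1 x2 y2 h1 h2|//]; first by rewrite cabs0.
by apply: le_trans (cabsD _ _) _; rewrite lerD.
Qed.

Lemma cabs_triangle (y x z : C) : cabs (x - z) <= cabs (x - y) + cabs (y - z).
Proof. by have := cabsD (x - y) (y - z); rewrite addrA subrK. Qed.

Lemma discE (z : C) rho w : disc z rho w <-> cabs (w - z) < rho.
Proof. by rewrite /disc /= cabsE ltcR. Qed.

Lemma nbhsCP (z : C) (P : set C) :
  nbhs z P <-> exists2 e : R, 0 < e & forall w, cabs (w - z) < e -> P w.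
Proof.
split=> [/nbhs_ballP[e e0 H]|[e e0 H]].
  case: e e0 H => a b /=; rewrite ltcE /= => /andP[/eqP -> a0] H.
  exists a => // w h; apply: H.
  by rewrite /ball /= cabsE -[a +i* 0]/(a%:C) ltcR cabsB.
apply/nbhs_ballP; exists e%:C; first by rewrite /= ltcR.
by move=> w; rewrite /ball /= cabsE ltcR cabsB; exact: H.
Qed.

Lemma cvgCP (T : Type) (F : set_system T) (h : T -> C) (l : C) : Filter F ->
  h @ F --> l <->
  forall e : R, 0 < e -> \forall x \near F, cabs (h x - l) < e.
Proof.
move=> FF; split=> [H e e0|H P /nbhsCP[e e0 HP]].
  by apply: (H [set w | cabs (w - l) < e]); apply/nbhsCP; exists e.
by apply: filterS (H e e0) => x; exact: HP.
Qed.

(** Convergence in modulus, for filters on any domain. Stating it with a real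
    bound keeps the topology of the codomain out of the terms. *)
Definition tends (T : Type) (F : set_system T) (f : T -> C) (l : C) : Prop :=
  forall e : R, 0 < e -> \forall x \near F, cabs (f x - l) < e.

Section Limits.
Context (T : topologicalType) (t : T).
Implicit Types (f g : T -> C) (a b : C).

Lemma tendsP f a : f x @[x --> t] --> a <-> tends (nbhs t) f a.
Proof. exact: cvgCP. Qed.

Lemma tends_eq f a b : a = b -> tends (nbhs t) f a -> tends (nbhs t) f b.
Proof. by move=> ->. Qed.

Lemma tendsD f g a b : tends (nbhs t) f a -> tends (nbhs t) g b ->
  tends (nbhs t) (fun x => f x + g x) (a + b).
Proof.
move=> /tendsP fa /tendsP gb; apply/tendsP.
exact: (@cvgD C C^o T (nbhs t) _ f g a b fa gb).
Qed.

Lemma tendsN f a : tends (nbhs t) f a -> tends (nbhs t) (fun x => - f x) (- a).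
Proof.
move=> /tendsP fa; apply/tendsP; exact: (@cvgN C C^o T (nbhs t) _ f a fa).
Qed.

Lemma tendsB f g a b : tends (nbhs t) f a -> tends (nbhs t) g b ->
  tends (nbhs t) (fun x => f x - g x) (a - b).
Proof. by move=> fa gb; apply: tendsD fa (tendsN gb). Qed.

Lemma tendsM f g a b : tends (nbhs t) f a -> tends (nbhs t) g b ->
  tends (nbhs t) (fun x => f x * g x) (a * b).
Proof.
move=> /tendsP fa /tendsP gb; apply/tendsP.
exact: (@cvgM C T (nbhs t) _ f g a b fa gb).
Qed.

Lemma tendsV f a : tends (nbhs t) f a -> a != 0 ->
  tends (nbhs t) (fun x => (f x)^-1) a^-1.
Proof.
move=> /tendsP fa a0; apply/tendsP; exact: (@cvgV C T (nbhs t) _ f a a0 fa).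
Qed.

Lemma tends_cst a : tends (nbhs t) (fun=> a) a.
Proof. by move=> e e0; apply: filterE => x; rewrite subrr cabs0. Qed.

Lemma tends_sum (I : Type) (r : seq I) (f : I -> T -> C) (a : I -> C) :
  (forall i, tends (nbhs t) (f i) (a i)) ->
  tends (nbhs t) (fun x => \sum_(i <- r) f i x) (\sum_(i <- r) a i).
Proof.
move=> H; elim: r => [|i r IH].
  rewrite big_nil (_ : (fun x => _) = fun=> 0); first exact: tends_cst.
  by apply/funext => x; rewrite big_nil.
rewrite big_cons (_ : (fun x => _) = fun x => f i x + \sum_(j <- r) f j x).
  exact: tendsD.
by apply/funext => x; rewrite big_cons.
Qed.

End Limits.

Lemma tends_comp (T U : Type) (F : set_system T) (G : set_system U)
    (h : T -> U) (f : U -> C) (a : C) :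
  Filter F -> h @ F --> G -> tends G f a -> tends F (f \o h) a.
Proof. by move=> FF hG fa e e0; exact: hG (fa e e0). Qed.

Lemma tends_at (T : topologicalType) (t : T) (f : T -> C) (a : C) :
  tends (nbhs t) f a -> f t = a.
Proof.
move=> fa; apply/eqP; rewrite -subr_eq0 -cabs_eq0; apply/negPn/negP => h.
have e0 : 0 < cabs (f t - a) by rewrite lt_def h cabs_ge0.
by have := nbhs_singleton (fa _ e0); rewrite ltxx.
Qed.

End Complex.

(** * Derivatives as continuous slopes *)

(** Caratheodory's form of the derivative: the difference quotient of h with
    respect to iota extends continuously to t, with value d. For iota the
    identity of the complex plane it is complex differentiability, for iota
    the inclusion of the real line it is differentiability of a path; both
    share the same sum, product and chain rules. *)
Definition has_slope {R : realType} {T : topologicalType}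
    (iota h : T -> R[i]) (t : T) (d : R[i]) : Prop :=
  exists2 s : T -> R[i], tends (nbhs t) s d &
    forall x, h x - h t = s x * (iota x - iota t).

Notation cderiv := (has_slope id).
Notation rderiv := (@has_slope _ (Real.sort _) (fun x => real_complex _ x)).

Section Slopes.
Context {R : realType} {T : topologicalType}.
Local Notation C := R[i].
Variables (iota : T -> C) (t : T).
Hypothesis iota_cont : tends (nbhs t) iota (iota t).
Implicit Types (g h : T -> C) (d e : C).

Lemma slope_eq h d e : d = e -> has_slope iota h t d -> has_slope iota h t e.
Proof. by move=> ->. Qed.

Lemma slope_ext g h d : g =1 h -> has_slope iota g t d -> has_slope iota h t d.
Proof. by move=> gh [s sd sE]; exists s => // x; rewrite -!gh. Qed.

Lemma slope_continuous h d : has_slope iota h t d -> tends (nbhs t) h (h t).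
Proof.
move=> [s sd sE].
rewrite (_ : h = fun x => s x * (iota x - iota t) + h t); last first.
  by apply/funext => x; rewrite -sE subrK.
apply: (tends_eq _ (tendsD (tendsM sd (tendsB iota_cont (tends_cst t (iota t))))
                   (tends_cst t (h t)))).
by rewrite subrr !mulr0.
Qed.

Lemma slope_cst d : has_slope iota (fun=> d) t 0.
Proof. by exists (fun=> 0); [exact: tends_cst|move=> x; rewrite subrr mul0r]. Qed.

Lemma slope_id : has_slope iota iota t 1.
Proof. by exists (fun=> 1); [exact: tends_cst|move=> x; rewrite mul1r]. Qed.

Lemma slopeD g h d e : has_slope iota g t d -> has_slope iota h t e ->
  has_slope iota (fun x => g x + h x) t (d + e).
Proof.
move=> [s sd sE] [s' sd' sE']; exists (fun x => s x + s' x); first exact: tendsD.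
by move=> x; rewrite mulrDl -sE -sE'; ring.
Qed.

Lemma slopeN g d : has_slope iota g t d ->
  has_slope iota (fun x => - g x) t (- d).
Proof.
move=> [s sd sE]; exists (fun x => - s x); first exact: tendsN.
by move=> x; rewrite mulNr -sE; ring.
Qed.

Lemma slopeB g h d e : has_slope iota g t d -> has_slope iota h t e ->
  has_slope iota (fun x => g x - h x) t (d - e).
Proof. by move=> gd he; apply: slopeD => //; exact: slopeN. Qed.

Lemma slopeM g h d e : has_slope iota g t d -> has_slope iota h t e ->
  has_slope iota (fun x => g x * h x) t (d * h t + g t * e).
Proof.
move=> gd he; have gc := slope_continuous gd.
case: gd he => [s sd sE] [s' sd' sE'].
exists (fun x => s x * h t + g x * s' x).
  by apply: tendsD; apply: tendsM => //; exact: tends_cst.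
by move=> x; rewrite mulrDl mulrAC -sE -mulrA -sE'; ring.
Qed.

Lemma slopeZ c g d : has_slope iota g t d ->
  has_slope iota (fun x => c * g x) t (c * d).
Proof.
move=> gd; apply: slope_eq (slopeM (slope_cst c) gd).
by rewrite mul0r add0r.
Qed.

Lemma slope_sum (I : eqType) (r : seq I) (g : I -> T -> C) (d : I -> C) :
  (forall i, i \in r -> has_slope iota (g i) t (d i)) ->
  has_slope iota (fun x => \sum_(i <- r) g i x) t (\sum_(i <- r) d i).
Proof.
elim: r => [|i r IH] H.
  rewrite big_nil; apply: slope_ext (slope_cst 0) => x.
  by rewrite big_nil.
have dr : has_slope iota (fun x => \sum_(i <- r) g i x) t (\sum_(i <- r) d i).
  by apply: IH => k kr; apply: H; rewrite inE kr orbT.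
rewrite big_cons; apply: slope_ext (slopeD (H i (mem_head _ _)) dr) => x.
by rewrite big_cons.
Qed.

Lemma slope_comp f h d e : has_slope iota h t d -> cderiv f (h t) e ->
  has_slope iota (fun x => f (h x)) t (e * d).
Proof.
move=> hd; have hc := slope_continuous hd; case: hd => s sd sE.
move=> [s' sd' sE']; exists (fun x => s' (h x) * s x).
  by apply: tendsM => //; apply: (@tends_comp _ _ _ _ _ h s' e _ _ sd'); apply/tendsP.
by move=> x; rewrite -mulrA -sE -sE'.
Qed.

Lemma slopeX g d k : has_slope iota g t d ->
  has_slope iota (fun x => g x ^+ k) t (k%:R * g t ^+ k.-1 * d).
Proof.
move=> gd; elim: k => [|k IH].
  rewrite !mul0r; exact: slope_cst.
apply: slope_ext (slope_eq _ (slopeM gd IH)) => [x|]; first by rewrite exprS.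
case: k {IH} => [|k]; first by rewrite !expr0; ring.
by rewrite /= (mulrC d) -[k.+2%:R]natr1 exprS; ring.
Qed.

Lemma slope_eps h d (e : R) : has_slope iota h t d -> 0 < e ->
  \forall x \near t,
    cabs (h x - h t - d * (iota x - iota t)) <= e * cabs (iota x - iota t).
Proof.
move=> [s sd sE] e0.
apply: filterS (sd e e0) => x xe.
by rewrite sE -mulrBl cabsM ler_wpM2r ?cabs_ge0// ltW.
Qed.

End Slopes.

Section ComplexDerivative.
Context {R : realType}.
Local Notation C := R[i].
Implicit Types (f g : C -> C) (z w d e : C).

Lemma tends_id z : tends (nbhs z) id z.
Proof. by apply/tendsP; exact: cvg_id. Qed.

Lemma tends_real_complex (t : R) : tends (nbhs t) (real_complex R) t%:C.
Proof.
move=> e e0.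
apply/nbhs_ballP; exists e => // x; rewrite /ball /= => tx.
have -> : real_complex R x - t%:C = (x - t : R)%:C by rewrite rmorphB.
by rewrite cabsR distrC.
Qed.

Lemma cderiv_epsP f z d :
  cderiv f z d <-> forall e : R, 0 < e ->
    \forall w \near z, cabs (f w - f z - d * (w - z)) <= e * cabs (w - z).
Proof.
split=> [fd e e0|H]; first exact: slope_eps.
exists (fun w => if w == z then d else (f w - f z) / (w - z)).
  move=> e e0; have e20 : 0 < e / 2 by rewrite divr_gt0.
  apply: filterS (H _ e20) => w; case: eqVneq => [->|wz] hw.
    by rewrite subrr cabs0.
  have wz0 : w - z != 0 by rewrite subr_eq0.
  have -> : (f w - f z) / (w - z) - d = (f w - f z - d * (w - z)) / (w - z).
    by rewrite [RHS]mulrBl mulfK.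
  rewrite cabsM cabsV ltr_pdivrMr ?cabs_gt0//.
  apply: (le_lt_trans hw); rewrite ltr_pM2r ?cabs_gt0//.
  by rewrite ltr_pdivrMr// ltr_pMr// ltr1n.
move=> w; case: eqVneq => [->|wz]; first by rewrite !subrr mulr0.
by rewrite divfK// subr_eq0.
Qed.

Lemma cderiv_near f g z d : (\forall w \near z, f w = g w) ->
  cderiv f z d -> cderiv g z d.
Proof.
move=> fg /cderiv_epsP H; apply/cderiv_epsP => e e0.
have fgz := nbhs_singleton fg.
by apply: filterS2 fg (H e e0) => w <-; rewrite -fgz.
Qed.

Lemma cderiv_inv z : z != 0 -> cderiv (fun w => w^-1) z (- z^-1 ^+ 2).
Proof.
move=> z0; have zc := tendsV (tends_id z) z0.
have nz : \forall w \near z, w != 0.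
  apply/nbhsCP; exists (cabs z); first by rewrite cabs_gt0.
  by move=> w; apply: contraTneq => ->; rewrite sub0r cabsN ltxx.
(* As 0^-1 = 0, no slope function fits w^-1 at w = 0; the function is first
   changed there, away from z, into its linear approximation at z. *)
apply: (@cderiv_near (fun w => if w == 0 then z^-1 - z^-1 ^+ 2 * (w - z) else w^-1)).
  by apply: filterS nz => w /negPf ->.
exists (fun w => if w == 0 then - z^-1 ^+ 2 else - (z^-1 * w^-1)).
  move=> e e0.
  have := tendsN (tendsM (tends_cst z z^-1) zc).
  rewrite -expr2 => /(_ e e0); apply: filterS => w.
  by case: ifP => // _; rewrite subrr cabs0.
move=> w; rewrite (negPf z0); case: eqVneq => [->|w0]; first by ring.
by field; rewrite z0 w0.
Qed.

Lemma is_deriveCP f z d : is_derive (z : C) (1 : C) f d <-> cderiv f z d.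
Proof.
have E : is_derive (z : C) (1 : C) f d <->
    (h^-1 * (f (h + z) - f z) @[h --> (0 : C)^'] --> d).
  have EQ : (fun h : C => h^-1 *: ((f \o shift z) (h *: (1 : C)) - f z)) =
            (fun h : C => h^-1 * (f (h + z) - f z)).
    by apply/funext => h; rewrite /= [h *: 1]mulr1.
  split=> [[fd <-]|fd].
    by move: fd; rewrite /derivable /derive EQ.
  split.
    by rewrite /derivable EQ; apply/cvg_ex; exists d.
  by rewrite /derive EQ; exact: cvg_lim.
rewrite E; split=> [/cvgCP H|].
  exists (fun w => if w == z then d else (f w - f z) / (w - z)); last first.
    move=> w; case: eqVneq => [->|wz]; first by rewrite !subrr mulr0.
    by rewrite divfK// subr_eq0.
  move=> e e0; move: H => /(_ e e0).
  move=> /nbhsCP[r r0 hr]; apply/nbhsCP; exists r => // w wz.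
  case: eqVneq => [_|wNz]; first by rewrite subrr cabs0.
  have := hr (w - z); rewrite subr0 subrK (mulrC _^-1); apply => //.
  by rewrite subr_eq0.
move=> [s sd sE]; apply/cvgCP => e e0; move: sd => /(_ e e0).
move=> /nbhsCP[r r0 hr]; apply/nbhsCP; exists r => // h; rewrite subr0 => hh h0.
by rewrite sE /= addrK (mulrC (s _)) mulKf//; apply: hr; rewrite addrK.
Qed.

Lemma cderiv_unique f z d e : cderiv f z d -> cderiv f z e -> d = e.
Proof. by move=> /is_deriveCP[_ <-] /is_deriveCP[_ <-]. Qed.

Lemma cderiv_derive1 f z d : cderiv f z d -> derive1 f z = d.
Proof. by move=> /is_deriveCP[_ <-]; rewrite derive1E. Qed.

Lemma tends_Re (T : Type) (F : set_system T) (h : T -> C) l :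
  Filter F -> tends F h l -> complex.Re (h x) @[x --> F] --> (complex.Re l : R).
Proof.
move=> FF H; apply/(@cvgrPdist_lt R R^o) => e e0.
apply: filterS (H e e0) => x; apply: le_lt_trans.
by rewrite distrC -raddfB absRe.
Qed.

Lemma tends_Im (T : Type) (F : set_system T) (h : T -> C) l :
  Filter F -> tends F h l -> complex.Im (h x) @[x --> F] --> (complex.Im l : R).
Proof.
move=> FF H; apply/(@cvgrPdist_lt R R^o) => e e0.
apply: filterS (H e e0) => x; apply: le_lt_trans.
by rewrite distrC -raddfB absIm.
Qed.

Lemma tends_ReIm (T : Type) (F : set_system T) (h : T -> C) l :
  Filter F -> complex.Re (h x) @[x --> F] --> (complex.Re l : R) ->
  complex.Im (h x) @[x --> F] --> (complex.Im l : R) -> tends F h l.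
Proof.
move=> FF /(@cvgrPdist_lt R R^o) H1 /(@cvgrPdist_lt R R^o) H2.
move=> e e0; have e20 : 0 < e / 2 by rewrite divr_gt0.
apply: filterS2 (H1 _ e20) (H2 _ e20) => x h1 h2.
rewrite cabsB (splitr e); apply: le_lt_trans (cabs_ReIm _) (ltrD _ _).
  by rewrite raddfB.
by rewrite raddfB.
Qed.

Lemma rderivP (h : R -> C) (t : R) d : rderiv h t d <->
  is_derive t (1 : R) (fun x => complex.Re (h x)) (complex.Re d) /\
  is_derive t (1 : R) (fun x => complex.Im (h x)) (complex.Im d).
Proof.
split=> [[s sd sE]|[/is_derive1_caratheodory[a [aE ac ad]]
                    /is_derive1_caratheodory[b [bE bc bd]]]].
  have ReIm x : complex.Re (h x) - complex.Re (h t) = complex.Re (s x) * (x - t) /\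
                complex.Im (h x) - complex.Im (h t) = complex.Im (s x) * (x - t).
    have := sE x; rewrite -rmorphB /=.
    case: (h x) (h t) (s x) => [h1 h2] [k1 k2] [s1 s2] [] /= -> ->.
    by rewrite !mulr0 subr0 add0r.
  have st := tends_at sd; split; apply/is_derive1_caratheodory.
    exists (fun x => complex.Re (s x)); split; last by rewrite st.
      by move=> x; case: (ReIm x).
    by rewrite -st in sd; exact: tends_Re sd.
  exists (fun x => complex.Im (s x)); split; last by rewrite st.
    by move=> x; case: (ReIm x).
  by rewrite -st in sd; exact: tends_Im sd.
exists (fun x => a x +i* b x).
  by apply: tends_ReIm; rewrite /= -?ad -?bd.
move=> x; rewrite -rmorphB /=; have := aE x; have := bE x.
case: (h x) (h t) => [h1 h2] [k1 k2] /= e2 e1.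
by congr (_ +i* _); rewrite /= ?e1 ?e2 mulr0 ?subr0 ?add0r.
Qed.

End ComplexDerivative.

(** * Complex integrals over the unit interval *)

Section Integral.
Context {R : realType}.
Local Notation C := R[i].
Implicit Types (h k F : R -> C) (c : C).
Local Notation mu := (@lebesgue_measure R).

(** Two-sided continuity at the points of [0, 1]; the paths are defined on the
    whole line. *)
Definition cont01 h := forall t : R, 0 <= t <= 1 -> tends (nbhs t) h (h t).

Definition cint h : C :=
  (\int[mu]_(t in `[0, 1]) complex.Re (h t))%R +i*
  (\int[mu]_(t in `[0, 1]) complex.Im (h t))%R.

Lemma cont01_cst c : cont01 (fun=> c).
Proof. by move=> t _; exact: tends_cst. Qed.

Lemma cont01D h k : cont01 h -> cont01 k -> cont01 (fun t => h t + k t).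
Proof. by move=> hc kc t t01; apply: tendsD; [exact: hc|exact: kc]. Qed.

Lemma cont01N h : cont01 h -> cont01 (fun t => - h t).
Proof. by move=> hc t t01; apply: tendsN; exact: hc. Qed.

Lemma cont01M h k : cont01 h -> cont01 k -> cont01 (fun t => h t * k t).
Proof. by move=> hc kc t t01; apply: tendsM; [exact: hc|exact: kc]. Qed.

Lemma cont01_comp (g : C -> C) h : cont01 h ->
  (forall t, 0 <= t <= 1 -> tends (nbhs (h t)) g (g (h t))) ->
  cont01 (fun t => g (h t)).
Proof.
move=> hc gc t t01; apply: (@tends_comp _ _ _ _ _ h g _ _ _ (gc _ t01)).
by apply/tendsP; exact: hc.
Qed.

Lemma cont01_real : cont01 (fun t => t%:C).
Proof. by move=> t _; exact: tends_real_complex. Qed.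

Let within01 (f : R -> R) :
  (forall t : R, 0 <= t <= 1 -> f x @[x --> t] --> f t) ->
  {within `[0, 1], continuous f}.
Proof.
move=> fc; apply: continuous_in_subspaceT => t.
by rewrite inE /= in_itv /=; exact: fc.
Qed.

Let integrable01 (f : R -> R) :
  (forall t : R, 0 <= t <= 1 -> f x @[x --> t] --> f t) ->
  mu.-integrable `[0, 1] (EFin \o f).
Proof.
move=> fc; apply: continuous_compact_integrable; first exact: segment_compact.
exact: within01.
Qed.

Let intRe h : cont01 h -> mu.-integrable `[0, 1] (EFin \o (fun t => complex.Re (h t))).
Proof. by move=> hc; apply: integrable01 => t /hc; exact: tends_Re. Qed.

Let intIm h : cont01 h -> mu.-integrable `[0, 1] (EFin \o (fun t => complex.Im (h t))).
Proof. by move=> hc; apply: integrable01 => t /hc; exact: tends_Im. Qed.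

Lemma eq_cint h k : (forall t, 0 <= t <= 1 -> h t = k t) -> cint h = cint k.
Proof.
move=> hk; rewrite /cint; congr (_ +i* _); apply: eq_Rintegral => t;
  by rewrite inE /= in_itv /= => /hk ->.
Qed.

Lemma cintD h k : cont01 h -> cont01 k ->
  cint (fun t => h t + k t) = cint h + cint k.
Proof.
move=> hc kc; rewrite /cint.
rewrite -[RHS]/((_ + _) +i* (_ + _)); congr (_ +i* _).
  rewrite -RintegralD//; [|exact: intRe|exact: intRe].
  by apply: eq_Rintegral => t _; rewrite raddfD.
rewrite -RintegralD//; [|exact: intIm|exact: intIm].
by apply: eq_Rintegral => t _; rewrite raddfD.
Qed.

Let RintegralZ (f : R -> R) (a : R) :
  mu.-integrable `[0, 1] (EFin \o f) ->
  (\int[mu]_(t in `[0, 1]) (a * f t) = a * \int[mu]_(t in `[0, 1]) f t)%R.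
Proof. by move=> fi; rewrite RintegralZl. Qed.

Lemma cintZ c h : cont01 h -> cint (fun t => c * h t) = c * cint h.
Proof.
move=> hc; case: c => a b; rewrite /cint.
have iR := intRe hc; have iI := intIm hc.
have iZ (x : R) (f : R -> R) : mu.-integrable `[0, 1] (EFin \o f) ->
    mu.-integrable `[0, 1] (EFin \o (fun t => x * f t)).
  move=> fi; rewrite (_ : _ \o _ = (fun t => x%:E * (EFin \o f) t)%E); last first.
    by apply/funext => t /=; rewrite EFinM.
  exact: integrableZl.
rewrite -[RHS]/((_ - _) +i* (_ + _)); congr (_ +i* _).
  rewrite -!RintegralZ// -RintegralB//; [|exact: iZ|exact: iZ].
  by apply: eq_Rintegral => t _; case: (h t).
rewrite -!RintegralZ// -RintegralD//; [|exact: iZ|exact: iZ].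
by apply: eq_Rintegral => t _; case: (h t) => x y /=; rewrite addrC.
Qed.

Lemma cintB h k : cont01 h -> cont01 k ->
  cint (fun t => h t - k t) = cint h - cint k.
Proof.
move=> hc kc; rewrite cintD//; last exact: cont01N.
congr (_ + _); rewrite -mulN1r -cintZ//.
by apply: eq_cint => t _; rewrite mulN1r.
Qed.

Lemma cint_cst c : cint (fun=> c) = c.
Proof.
rewrite /cint !Rintegral_cst//= lebesgue_measure_itv /= lte_fin ltr01.
by rewrite oppr0 addr0 /= !mulr1; case: c.
Qed.

(** The factor 2 comes from bounding the real and imaginary parts separately.
    *)
Lemma cint_le h (M : R) : cont01 h ->
  (forall t, 0 <= t <= 1 -> cabs (h t) <= M) -> cabs (cint h) <= 2 * M.
Proof.
move=> hc hM.
have H (f : R -> R) : mu.-integrable `[0, 1] (EFin \o f) ->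
    (forall t, 0 <= t <= 1 -> `|f t| <= M) ->
    `|\int[mu]_(t in `[0, 1]) f t|%R <= M.
  move=> fi fM; apply: le_trans (le_normr_Rintegral _ fi) _ => //.
  have -> : M = (\int[mu]_(t in `[0, 1]) (cst M t))%R.
    rewrite Rintegral_cst//= lebesgue_measure_itv /= lte_fin ltr01.
    by rewrite oppr0 addr0 /= mulr1.
  apply: le_Rintegral; first by [].
  - exact: (integrable_norm fi).
  - by apply: integrable01 => t _; exact: cvg_cst.
  - by move=> t; rewrite /= in_itv /=; exact: fM.
apply: le_trans (cabs_ReIm _) _; rewrite mulr_natl mulr2n lerD//=.
  by apply: H; [exact: intRe|move=> t /hM; apply: le_trans; exact: absRe].
by apply: H; [exact: intIm|move=> t /hM; apply: le_trans; exact: absIm].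
Qed.

Lemma cint_FTC F f : (forall t : R, 0 <= t <= 1 -> rderiv F t (f t)) ->
  cont01 f -> cint f = F 1 - F 0.
Proof.
move=> Ff fc.
have H (G g : R -> R) :
    (forall t : R, 0 <= t <= 1 -> is_derive t (1 : R) G (g t)) ->
    (forall t : R, 0 <= t <= 1 -> g x @[x --> t] --> g t) ->
    (\int[mu]_(t in `[0, 1]) g t = G 1 - G 0)%R.
  move=> Gg gc; rewrite /Rintegral (@continuous_FTC2 _ g G)//.
  - exact: within01.
  - have Gc t : 0 <= t <= 1 -> {for t, continuous G}.
      move=> /Gg[Gd _]; apply: differentiable_continuous.
      by apply/derivable1_diffP.
    split.
    + move=> t; rewrite in_itv /= => /andP[t0 t1].
      by have [] := Gg t _; rewrite ?(ltW t0) ?(ltW t1).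
    + by apply: cvg_at_right_filter; apply: Gc; rewrite lexx ler01.
    + by apply: cvg_at_left_filter; apply: Gc; rewrite lexx ler01.
  - move=> t; rewrite in_itv /= => /andP[t0 t1].
    by rewrite derive1E; case: (Gg t _) => //; rewrite ?(ltW t0) ?(ltW t1).
have HRe : (\int[mu]_(t in `[0, 1]) complex.Re (f t) =
            complex.Re (F 1) - complex.Re (F 0))%R.
  apply: (H (fun t => complex.Re (F t)) (fun t => complex.Re (f t))).
    by move=> t /Ff /rderivP[].
  by move=> t /fc; exact: tends_Re.
have HIm : (\int[mu]_(t in `[0, 1]) complex.Im (f t) =
            complex.Im (F 1) - complex.Im (F 0))%R.
  apply: (H (fun t => complex.Im (F t)) (fun t => complex.Im (f t))).
    by move=> t /Ff /rderivP[].
  by move=> t /fc; exact: tends_Im.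
by rewrite /cint HRe HIm; case: (F 1) (F 0) => a b [c d].
Qed.

End Integral.

(** * The mean value inequality *)

Section MeanValue.
Context {R : realType}.
Local Notation C := R[i].

(** Cousin's lemma. The supremum c of the y with P 0 y satisfies P 0 c by the
    local hypothesis at c, which also carries P beyond c when c < 1. *)
Lemma cousin (P : R -> R -> Prop) :
  (forall x y z : R, 0 <= x -> x <= y -> y <= z -> z <= 1 ->
     P x y -> P y z -> P x z) ->
  (forall t : R, 0 <= t <= 1 -> exists2 d : R, 0 < d &
     forall x y, 0 <= x -> x <= t -> t <= y -> y <= 1 ->
       t - x < d -> y - t < d -> P x y) ->
  P 0 1.
Proof.
move=> Padd Ploc.
pose S := [set y : R | 0 <= y <= 1 /\ P 0 y].
have S0 : S 0.
  split; first by rewrite lexx ler01.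
  have [|d d0 H] := Ploc 0; first by rewrite lexx ler01.
  by apply: H; rewrite ?lexx ?ler01 ?subrr.
have S1 : ubound S 1 by move=> y [/andP[]].
have supS : has_sup S by split; [exists 0|exists 1].
have c01 : 0 <= sup S <= 1.
  apply/andP; split; first by apply: ub_le_sup => //; exists 1.
  by apply: ge_sup => //; exists 0.
have [d d0 H] := Ploc _ c01.
have [s [/andP[s0 s1] Ps] sc] := sup_adherent d0 supS.
have sle : s <= sup S.
  by apply: ub_le_sup; [exists 1|split => //; rewrite s0 s1].
case/andP: c01 => c0 c1.
have cd : sup S < sup S + d / 2 by rewrite ltrDl divr_gt0.
pose y := Num.min 1 (sup S + d / 2).
have cy : sup S <= y by rewrite le_min c1 ltW.
have y1 : y <= 1 by rewrite ge_min lexx.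
have Py : P 0 y.
  apply: (Padd 0 s y) => //; first exact: le_trans cy.
  apply: H => //; first by rewrite ltrBlDr -ltrBlDl.
  rewrite ltrBlDl (@le_lt_trans _ _ (sup S + d / 2))//.
    by rewrite ge_min lexx orbT.
  by rewrite ltrD2l ltr_pdivrMr// ltr_pMr// ltr1n.
have yS : y <= sup S.
  apply: ub_le_sup; first by exists 1.
  by split => //; rewrite y1 (le_trans c0).
suff <- : y = 1 by [].
apply/eqP; rewrite eq_le y1 /=.
by move: yS; rewrite {1}/y ge_min [X in _ || X]leNgt cd orbF => /le_trans; apply.
Qed.

(** Around each t the increment of G is bounded by that of b up to an error e
    per unit length; such bounds add up over adjacent intervals, so cousin
    gives the bound on [0, 1] up to e. *)
Lemma mean_value_ineq (V : lmodType C) (nrm : V -> R) (G G' : R -> V)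
    (b b' : R -> R) :
  (forall X Y, nrm (X + Y) <= nrm X + nrm Y) ->
  (forall c X, nrm (c *: X) = cabs c * nrm X) ->
  (forall t : R, 0 <= t <= 1 -> forall e : R, 0 < e ->
     \forall s \near t, nrm (G s - G t - (s - t)%:C *: G' t) <= e * `|s - t|) ->
  (forall t : R, 0 <= t <= 1 -> is_derive t (1 : R) b (b' t)) ->
  (forall t, 0 <= t <= 1 -> nrm (G' t) <= b' t) ->
  nrm (G 1 - G 0) <= b 1 - b 0.
Proof.
move=> nD nZ dG db Gb; apply/ler_addgt0Pr => e e0.
have := @cousin (fun x y => nrm (G y - G x) <= b y - b x + e * (y - x)).
rewrite subr0 mulr1; apply.
  move=> x y z _ _ _ _ h1 h2.
  rewrite (_ : G z - G x = (G z - G y) + (G y - G x)); last by rewrite addrA subrK.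
  apply: le_trans (nD _ _) _; apply: le_trans (lerD h2 h1) _.
  by rewrite le_eqVlt; apply/orP; left; apply/eqP; ring.
move=> t t01; have e20 : 0 < e / 2 by rewrite divr_gt0.
have [s [sE sc st]] := (is_derive1_caratheodory _ _ _).1 (db t t01).
have bnear : \forall x \near t, `|s t - s x| < e / 2.
  by move/(@cvgrPdist_lt R R^o) : sc; apply.
have [d d0 dH] := (nbhs_ballP _ _).1 (filterI (dG t t01 _ e20) bnear).
have nN X : nrm (- X) = nrm X by rewrite -scaleN1r nZ cabsN cabs1 mul1r.
have key x : `|t - x| < d ->
    nrm (G x - G t) <= `|x - t| * (b' t + e / 2) /\ `|s x - b' t| <= e / 2.
  move=> /dH[h1 h2]; split; last by rewrite distrC -st ltW.
  rewrite -[G x - G t](subrK ((x - t)%:C *: G' t)) (le_trans (nD _ _))//.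
  rewrite nZ cabsR mulrDr addrC lerD//; first by rewrite ler_wpM2l// Gb.
  by rewrite mulrC.
exists d => // x y x0 xt ty y1 hx hy.
have [|kx sx] := key x; first by rewrite ger0_norm ?subr_ge0.
have [|ky sy] := key y; first by rewrite distrC ger0_norm ?subr_ge0.
rewrite (_ : G y - G x = (G y - G t) - (G x - G t)); last first.
  by rewrite opprB addrA subrK.
apply: le_trans (nD _ _) _; rewrite nN.
apply: le_trans (lerD ky kx) _.
have bx := sE x; have by_ := sE y.
rewrite (distrC x) !ger0_norm ?subr_ge0//.
rewrite (_ : b y - b x = (b y - b t) - (b x - b t)); last by ring.
rewrite by_ bx.
move: sx sy; rewrite !ler_norml => /andP[sx1 sx2] /andP[sy1 sy2].
have yt0 : 0 <= y - t by rewrite subr_ge0.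
have tx0 : 0 <= t - x by rewrite subr_ge0.
have sx0 : 0 <= s x - b' t + e / 2 by lra.
have sy0 : 0 <= s y - b' t + e / 2 by lra.
rewrite -subr_ge0 [leRHS](_ : _ = (y - t) * (s y - b' t + e / 2) +
  (t - x) * (s x - b' t + e / 2)); first by rewrite addr_ge0// mulr_ge0.
by field.
Qed.

End MeanValue.

(** * Differentiation under the integral sign *)

Section ParametricIntegral.
Context {R : realType}.
Local Notation C := R[i].

Lemma rderiv_affine (a b : C) (t : R) : rderiv (fun t => a + t%:C * b) t b.
Proof. by exists (fun=> b); [exact: tends_cst|move=> x; ring]. Qed.

Lemma rderiv_comp (f : C -> C) (h : R -> C) (t : R) (d e : C) :
  rderiv h t d -> cderiv f (h t) e -> rderiv (fun t => f (h t)) t (e * d).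
Proof. exact: (slope_comp (tends_real_complex t)). Qed.

Lemma cabs_mean_value (G G' : R -> C) (M : R) :
  (forall t : R, 0 <= t <= 1 -> rderiv G t (G' t)) ->
  (forall t : R, 0 <= t <= 1 -> cabs (G' t) <= M) ->
  cabs (G 1 - G 0) <= M.
Proof.
move=> dG GM.
have := @mean_value_ineq R C^o (@cabs R) G G' (fun t => t * M) (fun=> M).
rewrite mul1r mul0r subr0; apply => //.
- exact: cabsD.
- by move=> c X; rewrite -cabsM.
- move=> t t01 e e0; have := slope_eps (dG t t01) e0.
  by apply: filterS => s; rewrite -rmorphB /= cabsR mulrC.
- move=> t _; rewrite -[X in is_derive _ _ _ X]mulr1.
  rewrite (_ : (fun t => _) = M \*o (@id R)); last first.
    by apply/funext => x; rewrite /= mulrC.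
  exact: is_deriveZ.
Qed.

Definition open_set (U : set C) := forall z, U z -> \forall w \near z, U w.

Definition continuous_on (U : set C) (f : C -> C) :=
  forall z, U z -> tends (nbhs z) f (f z).

Definition deriv_on (U : set C) (f f' : C -> C) :=
  forall z, U z -> cderiv f z (f' z).

Lemma deriv_on_continuous U f f' : deriv_on U f f' -> continuous_on U f.
Proof. by move=> df z /df; apply: slope_continuous; exact: tends_id. Qed.

Lemma segment_disc (p w w' : C) (d t : R) : 0 <= t <= 1 ->
  cabs (w - p) < d -> cabs (w' - p) < d -> cabs (w + t%:C * (w' - w) - p) < d.
Proof.
move=> /andP[t0 t1] wd wd'.
rewrite (_ : _ - p = (1 - t)%:C * (w - p) + t%:C * (w' - p)); last first.
  by rewrite rmorphB rmorph1; ring.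
apply: le_lt_trans (cabsD _ _) _; rewrite !cabsM !cabsR.
rewrite !ger0_norm ?subr_ge0//.
have [->|tN0] := eqVneq t 0; first by rewrite subr0 mul1r mul0r addr0.
have tp : 0 < t by rewrite lt_def tN0.
rewrite [ltRHS](_ : d = (1 - t) * d + t * d); last by ring.
by rewrite ler_ltD ?ler_wpM2l ?subr_ge0 ?ltr_pM2l// ltW.
Qed.

(** A continuous derivative is strict: the mean value inequality on the
    segment from w to w' bounds the increment of f minus its linear part at w
    by the oscillation of f' near p. *)
Lemma strict_derivative (U : set C) f f' p : open_set U -> deriv_on U f f' ->
  continuous_on U f' -> U p -> forall e : R, 0 < e ->
  exists2 d : R, 0 < d & forall w w', cabs (w - p) < d -> cabs (w' - p) < d ->
    U w /\ cabs (f w' - f w - f' w * (w' - w)) <= e * cabs (w' - w).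
Proof.
move=> oU df cf' Up e e0; have e20 : 0 < e / 2 by rewrite divr_gt0.
have [d d0 dH] := (nbhsCP _ _).1 (filterI (oU _ Up) (cf' _ Up _ e20)).
exists d => // w w' wd wd'; split; first by case: (dH _ wd).
pose l (t : R) := w + t%:C * (w' - w).
have lU t : 0 <= t <= 1 -> U (l t) /\ cabs (f' (l t) - f' p) < e / 2.
  by move=> t01; apply: dH; exact: segment_disc.
have := @cabs_mean_value (fun t => f (l t) - (0 + t%:C * (f' w * (w' - w))))
  (fun t => (f' (l t) - f' w) * (w' - w)) (e * cabs (w' - w)).
have -> : l 0 = w by rewrite /l rmorph0 mul0r addr0.
have -> : l 1 = w' by rewrite /l rmorph1 mul1r addrC subrK.
rewrite rmorph0 rmorph1 mul0r mul1r !add0r subr0 addrAC; apply.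
  move=> t t01; rewrite mulrBl; apply: slopeB (rderiv_affine 0 _ t).
  apply: rderiv_comp (rderiv_affine w _ t) _; exact: df (lU t t01).1.
move=> t t01; rewrite cabsM ler_wpM2r ?cabs_ge0//.
apply: le_trans (cabs_triangle (f' p) _ _) _.
rewrite (splitr e) lerD// ltW//; first by case: (lU t t01).
by rewrite cabsB; case: (dH _ wd).
Qed.

(** Strict differentiability makes the remainder of the integrand uniformly
    small for t near any given t0 and x near x0; compactness of [0, 1] makes
    it uniform in t. *)
Lemma cint_parametric_derivative (U : set C) f f' (a b w : R -> C) (x0 : C) :
  open_set U -> deriv_on U f f' -> continuous_on U f' ->
  cont01 a -> cont01 b -> cont01 w ->
  (forall t : R, 0 <= t <= 1 -> U (a t + x0 * b t)) ->
  cderiv (fun x => cint (fun t => f (a t + x * b t) * w t)) x0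
         (cint (fun t => f' (a t + x0 * b t) * b t * w t)).
Proof.
move=> oU df cf' ac bc wc abU; apply/cderiv_epsP => e e0.
pose P x t := U (a t + x * b t) /\
  cabs (f (a t + x * b t) * w t - f (a t + x0 * b t) * w t
        - f' (a t + x0 * b t) * b t * w t * (x - x0))
  <= e / 2 * cabs (x - x0).
have Pnear : \forall x \near x0, `[0, 1]%classic `<=` P x.
  have /compact_near_coveringP : compact (`[0, 1]%classic : set R).
    exact: segment_compact.
  move=> /(_ C (nbhs x0) P); apply => t0; rewrite /= in_itv /= => t01.
  pose K := cabs (b t0) * cabs (w t0) + 1.
  have K0 : 0 < K by rewrite ltr_pwDr// mulr_ge0// cabs_ge0.
  have eK0 : 0 < e / 2 / K by rewrite !divr_gt0.
  have [d d0 dH] := strict_derivative oU df cf' (abU _ t01) eK0.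
  have nbw : \forall t \near t0, cabs (b t * w t) < K.
    have /(_ 1 ltr01) := tendsM (bc _ t01) (wc _ t01); apply: filterS => t h.
    rewrite -[b t * w t](subrK (b t0 * w t0)).
    by apply: le_lt_trans (cabsD _ _) _; rewrite /K addrC cabsM ltrD2l.
  have d20 : 0 < d / 2 by rewrite divr_gt0.
  pose B := cabs (b t0) + 1; have B0 : 0 < B by rewrite ltr_pwDr// cabs_ge0.
  have nb : \forall t \near t0, cabs (b t) < B.
    have /(_ 1 ltr01) := bc _ t01; apply: filterS => t h.
    rewrite -[b t](subrK (b t0)).
    by apply: le_lt_trans (cabsD _ _) _; rewrite /B addrC ltrD2l.
  have nt : \forall t \near t0,
      cabs (a t + x0 * b t - (a t0 + x0 * b t0)) < d / 2.
    exact: tendsD (ac _ t01) (tendsM (tends_cst t0 x0) (bc _ t01)) _ d20.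
  have nx : \forall x \near x0, cabs (x - x0) < d / 2 / B.
    by apply/nbhsCP; exists (d / 2 / B) => //; rewrite divr_gt0.
  exists ([set t | cabs (b t * w t) < K /\ cabs (b t) < B /\
            cabs (a t + x0 * b t - (a t0 + x0 * b t0)) < d / 2],
          [set x | cabs (x - x0) < d / 2 / B]).
    by split => //=; apply: filterI => //; exact: filterI.
  move=> [t x] [] /= [h1 [h2 h3]] h4.
  have wd : cabs (a t + x0 * b t - (a t0 + x0 * b t0)) < d.
    by apply: lt_trans h3 _; rewrite ltr_pdivrMr// ltr_pMr// ltr1n.
  have E : a t + x * b t - (a t + x0 * b t) = (x - x0) * b t by ring.
  have xb : cabs ((x - x0) * b t) < d / 2.
    rewrite cabsM (@le_lt_trans _ _ (cabs (x - x0) * B))//.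
      by rewrite ler_wpM2l ?cabs_ge0// ltW.
    by rewrite -ltr_pdivlMr.
  have wd' : cabs (a t + x * b t - (a t0 + x0 * b t0)) < d.
    rewrite (splitr d); apply: le_lt_trans (cabs_triangle (a t + x0 * b t) _ _) _.
    by rewrite E ltrD.
  split; first by have [] := dH _ _ wd' wd.
  have [_] := dH _ _ wd wd'; rewrite E => h5.
  rewrite (_ : _ - _ = (f (a t + x * b t) - f (a t + x0 * b t) -
     f' (a t + x0 * b t) * ((x - x0) * b t)) * w t); last by ring.
  rewrite cabsM; apply: le_trans (ler_wpM2r (cabs_ge0 _) h5) _.
  rewrite [leLHS](_ : _ = e / 2 * cabs (x - x0) * (cabs (b t * w t) / K)).
    rewrite ler_piMr//; first by rewrite mulr_ge0 ?cabs_ge0// ltW// divr_gt0.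
    by rewrite ler_pdivrMr// mul1r ltW.
  by rewrite !cabsM; ring.
have ab0 : cont01 (fun t => a t + x0 * b t).
  by apply: cont01D => //; apply: cont01M => //; exact: cont01_cst.
have cf := deriv_on_continuous df.
have f0c : cont01 (fun t => f (a t + x0 * b t) * w t).
  by apply: cont01M => //; apply: (cont01_comp ab0) => t /abU; exact: cf.
have f1c : cont01 (fun t => f' (a t + x0 * b t) * b t * w t).
  apply: cont01M => //; apply: cont01M => //.
  by apply: (cont01_comp ab0) => t /abU; exact: cf'.
apply: filterS Pnear => x Px.
have Px' t : 0 <= t <= 1 -> P x t by move=> t01; apply: Px; rewrite /= in_itv.
have fxc : cont01 (fun t => f (a t + x * b t) * w t).
  apply: cont01M => //; apply: (cont01_comp (g := f)).
    by apply: cont01D => //; apply: cont01M => //; exact: cont01_cst.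
  by move=> t /Px'[/cf].
rewrite -cintB// mulrC -cintZ// -cintB//; last 2 first.
- by apply: cont01D => //; exact: cont01N.
- by apply: cont01M => //; exact: cont01_cst.
rewrite [leRHS](_ : _ = 2 * (e / 2 * cabs (x - x0))); last by field.
apply: cint_le.
  apply: cont01D; first by apply: cont01D => //; exact: cont01N.
  by apply: cont01N; apply: cont01M => //; exact: cont01_cst.
by move=> t /Px'[_]; rewrite [(x - x0) * _]mulrC.
Qed.

End ParametricIntegral.

(** * Infinitely differentiable functions of a complex variable *)

Section Smooth.
Context {R : realType}.
Local Notation C := R[i].
Implicit Types (U V : set C) (f g : C -> C).

(** The successive derivatives are existentially quantified, hence constrained
    on U only, which makes closure under the algebraic operations a plain
    induction. *)
Fixpoint diff_times (n : nat) U g : Prop :=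
  if n is m.+1 then exists2 g', deriv_on U g g' & diff_times m U g'
  else True.

Definition smooth U g := forall n, diff_times n U g.

Lemma deriv_on_eq U g h g' : open_set U -> (forall z, U z -> g z = h z) ->
  deriv_on U g g' -> deriv_on U h g'.
Proof.
move=> oU gh dg z Uz; apply: cderiv_near (dg z Uz).
by apply: filterS (oU z Uz) => w; exact: gh.
Qed.

Lemma diff_times_eq n U g h : open_set U -> (forall z, U z -> g z = h z) ->
  diff_times n U g -> diff_times n U h.
Proof.
by case: n => //= n oU gh [g' dg g'n]; exists g' => //; exact: deriv_on_eq dg.
Qed.

Lemma diff_times_pred n U g : diff_times n.+1 U g -> diff_times n U g.
Proof.
elim: n g => // n IH g [g' dg g'n]; exists g' => //; exact: IH.
Qed.

Lemma diff_times_sub n U V g : V `<=` U -> diff_times n U g -> diff_times n V g.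
Proof.
move=> VU; elim: n g => //= n IH g [g' dg g'n]; exists g'; last exact: IH.
by move=> z /VU; exact: dg.
Qed.

Lemma diff_times_cst n U c : diff_times n U (fun=> c).
Proof.
elim: n c => //= n IH c; exists (fun=> 0); last exact: IH.
by move=> z _; exact: slope_cst.
Qed.

Lemma diff_times_id n U : diff_times n U id.
Proof.
case: n => //= n; exists (fun=> 1); last exact: diff_times_cst.
by move=> z _; exact: slope_id.
Qed.

Lemma diff_timesD n U g h : diff_times n U g -> diff_times n U h ->
  diff_times n U (fun z => g z + h z).
Proof.
elim: n g h => //= n IH g h [g' dg g'n] [h' dh h'n].
exists (fun z => g' z + h' z); last exact: IH.
by move=> z Uz; apply: slopeD; [exact: dg|exact: dh].
Qed.

Lemma diff_timesM n U g h : diff_times n U g -> diff_times n U h ->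
  diff_times n U (fun z => g z * h z).
Proof.
elim: n g h => // n IH g h gn hn.
have gm := diff_times_pred gn; have hm := diff_times_pred hn.
case: gn hn => [g' dg g'n] [h' dh h'n].
exists (fun z => g' z * h z + g z * h' z); last by apply: diff_timesD; exact: IH.
by move=> z Uz; apply: (slopeM (@tends_id R z)); [exact: dg|exact: dh].
Qed.

Lemma diff_times_horner n U (p : {poly C}) : diff_times n U (horner p).
Proof.
elim/poly_ind: p => [|p c IH].
  rewrite (_ : horner 0 = fun=> 0); first exact: diff_times_cst.
  by apply/funext => z; rewrite horner0.
rewrite (_ : horner _ = fun z => p.[z] * z + c); last first.
  by apply/funext => z; rewrite hornerMXaddC.
apply: diff_timesD; last exact: diff_times_cst.
by apply: diff_timesM => //; exact: diff_times_id.
Qed.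

Lemma diff_timesV n U g : (forall z, U z -> g z != 0) -> diff_times n U g ->
  diff_times n U (fun z => (g z)^-1).
Proof.
move=> g0; elim: n => // n IH gn; have gm := diff_times_pred gn.
case: gn => g' dg g'n.
exists (fun z => -1 * ((g z)^-1 * (g z)^-1) * g' z).
  move=> z Uz; have := slope_comp (@tends_id R z) (dg z Uz) (cderiv_inv (g0 z Uz)).
  by rewrite mulN1r expr2.
apply: diff_timesM => //; apply: diff_timesM; first exact: diff_times_cst.
by apply: diff_timesM; exact: IH.
Qed.

Lemma diff_times_affine n U V g a b : (forall z, V z -> U (a + b * z)) ->
  diff_times n U g -> diff_times n V (fun z => g (a + b * z)).
Proof.
move=> VU; elim: n g => //= n IH g [g' dg g'n].
exists (fun z => g' (a + b * z) * b).
  move=> z Vz; apply: slope_comp; first exact: tends_id; last exact: dg (VU _ Vz).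
  by exists (fun=> b); [exact: tends_cst|move=> x /=; ring].
by apply: diff_timesM; [exact: IH|exact: diff_times_cst].
Qed.

Lemma smooth_derive1 U g : open_set U -> smooth U g ->
  deriv_on U g (derive1 g) /\ smooth U (derive1 g).
Proof.
move=> oU gs; have dg : deriv_on U g (derive1 g).
  move=> z Uz; have [g' dg _] := gs 1%N.
  by rewrite (cderiv_derive1 (dg z Uz)); exact: dg.
split=> // n; have [g' dg' g'n] := gs n.+1.
apply: diff_times_eq g'n => // z Uz.
exact: cderiv_unique (dg' z Uz) (dg z Uz).
Qed.

Lemma smooth_derive1n U g k : open_set U -> smooth U g ->
  smooth U (derive1n k g).
Proof. by move=> oU gs; elim: k => //= k IH; case: (smooth_derive1 oU IH). Qed.

Lemma smooth_continuous U g : smooth U g -> continuous_on U g.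
Proof. by move=> /(_ 1%N)[g' dg _]; exact: deriv_on_continuous dg. Qed.

End Smooth.

(** * Division and primitives on a disc *)

Section Disc.
Context {R : realType}.
Local Notation C := R[i].
Variables (z0 : C) (rho : R).
Local Notation U := (disc z0 rho).
Implicit Types (g : C -> C) (a : C).

Lemma open_disc : open_set U.
Proof.
move=> z /discE zr; apply/nbhsCP; exists (rho - cabs (z - z0)).
  by rewrite subr_gt0.
move=> w; rewrite ltrBrDr => h; apply/discE.
exact: le_lt_trans (cabs_triangle z _ _) h.
Qed.

Lemma disc_segment a z (t : R) : 0 <= t <= 1 -> U a -> U z ->
  U (a - t%:C * a + z * t%:C).
Proof.
move=> t01 /discE az /discE zz; apply/discE.
rewrite (_ : a - _ + _ = a + t%:C * (z - a)); last by ring.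
exact: segment_disc.
Qed.

Let Icont a : cont01 (fun t => a - t%:C * a).
Proof.
apply: cont01D; first exact: cont01_cst.
by apply: cont01N; apply: cont01M; [exact: cont01_real|exact: cont01_cst].
Qed.

(** The mean of g over the segment from a to z, with weight t^k.
    Differentiation in z turns g into its derivative and k into k.+1. *)
Definition segment_average a g (k : nat) z :=
  cint (fun t => g (a - t%:C * a + z * t%:C) * t%:C ^+ k).

Lemma segment_average_deriv a g g' k : U a ->
  deriv_on U g g' -> continuous_on U g' ->
  deriv_on U (segment_average a g k) (segment_average a g' k.+1).
Proof.
move=> Ua dg cg' z Uz.
have kc : cont01 (fun t : R => t%:C ^+ k).
  elim: k => [|k IH]; first exact: cont01_cst.
  rewrite (_ : (fun t => _) = fun t : R => t%:C * t%:C ^+ k); last first.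
    by apply/funext => t; rewrite exprS.
  by apply: cont01M => //; exact: cont01_real.
have := cint_parametric_derivative open_disc dg cg' (Icont a) cont01_real kc
  (fun t t01 => disc_segment t01 Ua Uz).
apply: slope_eq; apply: eq_cint => t _.
by rewrite exprS mulrA.
Qed.

Lemma smooth_segment_average a g k : U a -> smooth U g ->
  smooth U (segment_average a g k).
Proof.
move=> Ua gs n; elim: n g k gs => // n IH g k gs.
have [dg g's] := smooth_derive1 open_disc gs.
exists (segment_average a (derive1 g) k.+1); last exact: IH.
exact: segment_average_deriv dg (smooth_continuous g's).
Qed.

Let segment_rderiv a z (t : R) :
  rderiv (fun t => a - t%:C * a + z * t%:C) t (z - a).
Proof. by exists (fun=> z - a); [exact: tends_cst|move=> x; ring]. Qed.

(** Hadamard's lemma: g(z) - g(a) is z - a times the mean of g' over the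
    segment from a to z. *)
Lemma smooth_divide a g : U a -> smooth U g ->
  exists2 g1, smooth U g1 & forall z, U z -> g z = g a + (z - a) * g1 z.
Proof.
move=> Ua gs; have [dg g's] := smooth_derive1 open_disc gs.
have g'c := smooth_continuous g's.
exists (segment_average a (derive1 g) 0); first exact: smooth_segment_average.
move=> z Uz.
pose l (t : R) := a - t%:C * a + z * t%:C.
have lc : cont01 l.
  by apply: cont01D => //; apply: cont01M; [exact: cont01_cst|exact: cont01_real].
have gl : cont01 (fun t => derive1 g (l t)).
  by apply: (cont01_comp lc) => t t01; apply: g'c; exact: disc_segment.
rewrite /segment_average.
rewrite (@eq_cint _ _ (fun t => derive1 g (l t))); last first.
  by move=> t _; rewrite expr0 mulr1.
rewrite -cintZ// (@cint_FTC _ (fun t => g (l t))).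
- rewrite /l rmorph1 rmorph0 mul1r subrr mulr1 add0r mul0r subr0 mulr0 addr0.
  by rewrite addrC subrK.
- move=> t t01; rewrite mulrC; apply: rderiv_comp; first exact: segment_rderiv.
  by apply: dg; exact: disc_segment.
- by apply: cont01M => //; exact: cont01_cst.
Qed.

(** The primitive is z - z0 times the mean of g over the segment from z0 to z;
    its derivative is the integral over [0, 1] of the derivative in t of t
    g(z0 + t (z - z0)). *)
Lemma smooth_primitive g : 0 < rho -> smooth U g -> exists P, deriv_on U P g.
Proof.
move=> rho0 gs; have [dg g's] := smooth_derive1 open_disc gs.
have g'c := smooth_continuous g's; have gc := smooth_continuous gs.
have Ua : U z0 by apply/discE; rewrite subrr cabs0.
exists (fun z => (z - z0) * segment_average z0 g 0 z) => z Uz.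
have idz := @tends_id R z.
apply: slope_eq (slopeM idz (slopeB (slope_id id z) (slope_cst id z z0))
  (segment_average_deriv 0 Ua dg g'c Uz)).
pose l (t : R) := z0 - t%:C * z0 + z * t%:C.
have lc : cont01 l.
  by apply: cont01D => //; apply: cont01M; [exact: cont01_cst|exact: cont01_real].
have lU (t : R) : 0 <= t <= 1 -> U (l t) by move=> t01; exact: disc_segment.
have gl : cont01 (fun t => g (l t)).
  by apply: (cont01_comp lc) => t t01; apply: gc; exact: lU.
have g'l : cont01 (fun t => derive1 g (l t) * t%:C).
  apply: cont01M; last exact: cont01_real.
  by apply: (cont01_comp lc) => t t01; apply: g'c; exact: lU.
rewrite subr0 mul1r /segment_average.
rewrite (@eq_cint _ _ (fun t => g (l t))); last by move=> t _; rewrite expr0 mulr1.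
rewrite [X in _ * X](@eq_cint _ _ (fun t => derive1 g (l t) * t%:C)); last first.
  by move=> t _; rewrite expr1.
rewrite -cintZ// -cintD//; last by apply: cont01M => //; exact: cont01_cst.
rewrite (@cint_FTC _ (fun t => t%:C * g (l t))).
- by rewrite rmorph0 mul0r subr0 rmorph1 mul1r /l rmorph1 mul1r subrr add0r mulr1.
- move=> t t01.
  have it := tends_real_complex t.
  apply: slope_eq (slopeM it (slope_id _ t)
    (rderiv_comp (segment_rderiv z0 z t) (dg _ (lU _ t01)))).
  by rewrite /l; ring.
- by apply: cont01D => //; apply: cont01M => //; exact: cont01_cst.
Qed.

End Disc.

(** * Termwise differentiation of power series *)

Section PowerSeries.
Context {R : realType}.
Local Notation C := R[i].
Implicit Types (c : nat -> C).

Lemma halfpow_mul (k : nat) : k%:R * (2^-1 : R) ^+ k <= 1.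
Proof.
have : (k <= 2 ^ k)%N by rewrite ltnW// ltn_expl.
rewrite -(ler_nat R) natrX => h.
by rewrite exprVn ler_pdivrMr ?exprn_gt0// mul1r.
Qed.

Lemma halfpow_sum (n : nat) : \sum_(k < n) (2^-1 : R) ^+ k <= 2.
Proof.
have -> : \sum_(k < n) (2^-1 : R) ^+ k = 2 - 2 * 2^-1 ^+ n.
  elim: n => [|n IH]; first by rewrite big_ord0 expr0 mulr1 subrr.
  by rewrite big_ord_recr /= IH exprS; field.
by rewrite gerBl mulr_ge0// exprn_ge0.
Qed.

Lemma series_cvg_of_halfpow c (M : R) :
  (forall k, cabs (c k) <= M * 2^-1 ^+ k) ->
  exists l : C, series c @ \oo --> l.
Proof.
move=> cM.
have H (u : nat -> R) : (forall k, `|u k| <= cabs (c k)) -> cvgn (series u).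
  move=> uc; apply: normed_cvg.
  apply: (@series_le_cvg _ _ (geometric M 2^-1)).
  - by move=> k /=; exact: normr_ge0.
  - move=> k /=; rewrite mulr_ge0 ?exprn_ge0//.
    by have := cM 0%N; rewrite expr0 mulr1; apply: le_trans; exact: cabs_ge0.
  - by move=> k; exact: le_trans (uc k) (cM k).
  - by apply: is_cvg_geometric_series; rewrite ger0_norm// invf_lt1// ltr1n.
have HR := H (fun k => complex.Re (c k)) (fun k => absRe (c k)).
have HI := H (fun k => complex.Im (c k)) (fun k => absIm (c k)).
exists (lim (series (fun k => complex.Re (c k)) @ \oo) +i*
        lim (series (fun k => complex.Im (c k)) @ \oo)).
apply/cvgCP; apply: tends_ReIm => /=.
  rewrite (_ : (fun n => _) = series (fun k => complex.Re (c k))) //.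
  by apply/funext => n; rewrite /series /= raddf_sum.
rewrite (_ : (fun n => _) = series (fun k => complex.Im (c k))) //.
by apply/funext => n; rewrite /series /= raddf_sum.
Qed.

Lemma series_term_bounded c (l : C) : series c @ \oo --> l ->
  exists M : R, forall k, cabs (c k) <= M.
Proof.
move=> /cvgCP /(_ 1 ltr01) [N _ HN].
exists (2 + \sum_(k < N) cabs (c k)) => k.
have S0 : 0 <= \sum_(k < N) cabs (c k) by apply: sumr_ge0 => i _; exact: cabs_ge0.
have [kN|Nk] := ltnP k N.
  rewrite (bigD1 (Ordinal kN)) //= addrCA lerDl addr_ge0//.
  by apply: sumr_ge0 => i _; exact: cabs_ge0.
have -> : c k = (series c k.+1 - l) - (series c k - l).
  by rewrite /series /= big_nat_recr//=; ring.
have h1 := HN k.+1 (leq_trans Nk (leqnSn _)); have h2 := HN k Nk.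
rewrite -[leLHS]addr0 lerD// (le_trans (cabsD _ _))// cabsN.
by rewrite -[leRHS]/(1 + 1) lerD// ltW.
Qed.

(** The second order remainders e_k of the powers satisfy e_(k+1) = z e_k + k
    z0^(k-1) (z - z0)^2. The factor s^2 on the left stands for the exponent k
    - 2 on the right. *)
Lemma power_increment (s : R) (z z0 : C) k : cabs z <= s -> cabs z0 <= s ->
  s ^+ 2 * cabs (z ^+ k - z0 ^+ k - k%:R * z0 ^+ k.-1 * (z - z0))
  <= k%:R ^+ 2 * s ^+ k * cabs (z - z0) ^+ 2.
Proof.
move=> zs z0s; have s0 : 0 <= s by exact: le_trans (cabs_ge0 _) zs.
have B0 : 0 <= cabs (z - z0) ^+ 2 by rewrite exprn_ge0// cabs_ge0.
set B := cabs (z - z0) ^+ 2 in B0 *.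
elim: k => [|k IH].
  by rewrite !expr0 !mul0r subrr subr0 cabs0 mulr0 expr0n /= !mul0r.
rewrite (_ : _ - _ - _ = z * (z ^+ k - z0 ^+ k - k%:R * z0 ^+ k.-1 * (z - z0)) +
    k%:R * z0 ^+ k.-1 * (z - z0) ^+ 2); last first.
  case: k {IH} => [|k]; first by rewrite /= !expr0; ring.
  by rewrite /= -[k.+2%:R]natr1 -[k.+1%:R]natr1 !exprS; ring.
have h2 : s ^+ 2 * cabs (k%:R * z0 ^+ k.-1 * (z - z0) ^+ 2) <=
    k%:R * s ^+ k.+1 * B.
  rewrite !cabsM !cabsX cabsn -/B.
  case: k {IH} => [|k]; first by rewrite !mul0r mulr0.
  rewrite /= -expr2 -/B.
  rewrite [leLHS](_ : _ = k.+1%:R * s ^+ 2 * B * cabs z0 ^+ k); last by ring.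
  rewrite [leRHS](_ : _ = k.+1%:R * s ^+ 2 * B * s ^+ k); last by rewrite !exprS; ring.
  apply: ler_wpM2l; first by rewrite mulr_ge0// mulr_ge0// exprn_ge0.
  by apply: lerXn2r => //; rewrite nnegrE ?cabs_ge0.
have h1 := ler_pM (cabs_ge0 z) (mulr_ge0 (exprn_ge0 2 s0) (cabs_ge0 _)) zs IH.
rewrite mulrCA -cabsM in h1.
apply: (@le_trans _ _ (s * (k%:R ^+ 2 * s ^+ k * B) + k%:R * s ^+ k.+1 * B)).
  apply: le_trans (lerD h1 h2).
  by rewrite -mulrDr; apply: ler_wpM2l; [exact: exprn_ge0|exact: cabsD].
rewrite -[k.+1%:R]natr1 [s ^+ k.+1]exprS -subr_ge0.
rewrite (_ : _ - _ = (k%:R + 1) * (s * s ^+ k) * B); last by ring.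
by apply: mulr_ge0 => //; apply: mulr_ge0; [exact: addr_ge0|rewrite -exprS exprn_ge0].
Qed.

(** The quadratic remainders of the partial sums are bounded uniformly in
    their length, so the bound passes to the limit. The radius r / 16 is
    convenient: if |z - w| and |z0 - w| are at most r / 16 and |a k| (r / 2)^k
    <= M, the k-th remainder is at most M k^2 8^-k <= M 2^-k, up to a constant
    factor. *)
Lemma power_series_derivative (a : nat -> C) (g : C -> C) (w : C) (r : R) :
  0 < r ->
  (forall z, disc w r z -> series (fun k => a k * (z - w) ^+ k) @ \oo --> g z) ->
  exists G : C -> C, forall z, disc w (r / 16) z -> cderiv g z (G z) /\
    series (fun k => k.+1%:R * a k.+1 * (z - w) ^+ k) @ \oo --> G z.
Proof.
move=> r0 ag; have [s sE] : exists s : R, s = r / 16 by exists (r / 16).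
have s0 : 0 < s by rewrite sE divr_gt0.
rewrite -sE.
have [M aM] : exists M : R, forall k, cabs (a k) * (8 * s) ^+ k <= M.
  have Dr : disc w r (w + (8 * s)%:C).
    apply/discE; rewrite addrC addKr cabsR ger0_norm ?mulr_ge0 ?ltW//.
    by rewrite sE mulrA ltr_pdivrMr// mulrC ltr_pM2l// ltr_nat.
  have [M HM] := series_term_bounded (ag _ Dr); exists M => k.
  apply: le_trans (HM k); rewrite cabsM cabsX addrC addKr cabsR ger0_norm//.
  by rewrite mulr_ge0 ?ltW.
have M0 : 0 <= M by have := aM 0%N; rewrite expr0 mulr1; apply: le_trans; exact: cabs_ge0.
have aM' k : cabs (a k) * s ^+ k <= M * (2^-1 ^+ k * 2^-1 ^+ k * 2^-1 ^+ k).
  have := aM k; rewrite exprMn mulrCA => h.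
  have -> : (2^-1 ^+ k * 2^-1 ^+ k * 2^-1 ^+ k : R) = (8 ^+ k)^-1.
    by rewrite -!exprMn -exprVn; congr (_ ^+ k); field.
  by rewrite ler_pdivlMr ?exprn_gt0// mulrC.
have h0 k : 0 <= (2^-1 : R) ^+ k by rewrite exprn_ge0.
have term1 k : k%:R ^+ 2 * (cabs (a k) * s ^+ k) <= M * 2^-1 ^+ k.
  apply: le_trans (ler_wpM2l (exprn_ge0 2 (ler0n _ k)) (aM' k)) _.
  rewrite [leLHS](_ : _ = M * 2^-1 ^+ k * (k%:R * 2^-1 ^+ k) ^+ 2); last first.
    by move: (2^-1 ^+ k) => q; ring.
  rewrite ler_piMr// ?mulr_ge0// expr_le1// ?mulr_ge0//.
  exact: halfpow_mul.
have dcv z : cabs (z - w) < s -> exists l : C,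
    series (fun k => k.+1%:R * a k.+1 * (z - w) ^+ k) @ \oo --> l.
  move=> zs; apply: (@series_cvg_of_halfpow _ (M / s)) => k.
  rewrite -(ler_pM2r s0) !cabsM cabsX cabsn.
  rewrite [leRHS](_ : _ = M * 2^-1 ^+ k); last by field; exact: lt0r_neq0.
  apply: (@le_trans _ _ (k.+1%:R ^+ 2 * (cabs (a k.+1) * s ^+ k.+1))).
    rewrite [s ^+ k.+1]exprSr !mulrA; apply: ler_wpM2r; first exact: ltW.
    apply: ler_pM.
    - by rewrite mulr_ge0 ?cabs_ge0 ?ler0n.
    - by rewrite exprn_ge0 ?cabs_ge0.
    - by rewrite ler_wpM2r ?cabs_ge0// expr2 ler_peMr// ler1n.
    - by apply: lerXn2r; rewrite ?nnegrE ?cabs_ge0 ?(ltW s0) ?(ltW zs).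
  apply: le_trans (term1 _) _; rewrite ler_wpM2l// exprS ler_piMl//.
  by rewrite invf_le1// ler1n.
have [G HG] : exists G : C -> C, forall z, cabs (z - w) < s ->
    series (fun k => k.+1%:R * a k.+1 * (z - w) ^+ k) @ \oo --> G z.
  have W (z : C) : exists l : C, cabs (z - w) < s ->
      series (fun k => k.+1%:R * a k.+1 * (z - w) ^+ k) @ \oo --> l.
    have [/dcv[l hl]|zs] := ltP (cabs (z - w)) s; first by exists l.
    by exists 0.
  by have [G HG] := choice W; exists G.
have sr : s < r by rewrite sE ltr_pdivrMr// ltr_pMr// ltr1n.
have quad z z' : cabs (z - w) < s -> cabs (z' - w) < s ->
    s ^+ 2 * cabs (g z - g z' - G z' * (z - z')) <= 2 * M * cabs (z - z') ^+ 2.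
  move=> zs z's; apply/ler_addgt0Pr => e e0.
  pose K := s ^+ 2 * (2 + cabs (z - z')).
  have K0 : 0 < K by rewrite mulr_gt0 ?exprn_gt0// ltr_pwDl// cabs_ge0.
  have eK : 0 < e / K by rewrite divr_gt0.
  have Dz : disc w r z by apply/discE; exact: lt_trans sr.
  have Dz' : disc w r z' by apply/discE; exact: lt_trans sr.
  have [N1 _ H1] := (cvgCP _ _ _).1 (ag _ Dz) _ eK.
  have [N2 _ H2] := (cvgCP _ _ _).1 (ag _ Dz') _ eK.
  have [N3 _ H3] := (cvgCP _ _ _).1 (HG _ z's) _ eK.
  pose n := (N1 + N2 + N3)%N.
  have {}H1 := H1 n.+1 _; have {}H2 := H2 n.+1 _; have {}H3 := H3 n _.
  have {}H1 := H1 (leqW (leq_trans (leq_addr _ _) (leq_addr _ _))).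
  have {}H2 := H2 (leqW (leq_trans (leq_addl _ _) (leq_addr _ _))).
  have {}H3 := H3 (leq_addl _ _).
  set S1 := series _ _ in H1; set S2 := series _ _ in H2; set S3 := series _ _ in H3.
  have bS : s ^+ 2 * cabs (S1 - S2 - S3 * (z - z')) <= 2 * M * cabs (z - z') ^+ 2.
    have -> : S1 - S2 - S3 * (z - z') = \sum_(k < n.+1) a k *
        ((z - w) ^+ k - (z' - w) ^+ k - k%:R * (z' - w) ^+ k.-1 * (z - z')).
      under eq_bigr do rewrite mulrBr mulrBr.
      rewrite !big_split/= !sumrN; congr (_ - _ - _).
      - by rewrite /S1 /series /= big_mkord.
      - by rewrite /S2 /series /= big_mkord.
      rewrite big_ord_recl mul0r mul0r mulr0 add0r /S3 /series /= big_mkord mulr_suml.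
      by apply: eq_bigr => k _; rewrite /bump /= add1n; ring.
    apply: le_trans (ler_wpM2l (exprn_ge0 2 (ltW s0)) (cabs_sum _)) _.
    rewrite mulr_sumr.
    apply: (@le_trans _ _ (\sum_(k < n.+1) (M * cabs (z - z') ^+ 2) * 2^-1 ^+ k)).
      apply: ler_sum => k _; rewrite cabsM mulrCA.
      have := power_increment k (ltW zs) (ltW z's).
      rewrite (_ : z - w - (z' - w) = z - z'); last by ring.
      move=> /(ler_wpM2l (cabs_ge0 (a k))) /le_trans; apply.
      rewrite (_ : _ * _ = k%:R ^+ 2 * (cabs (a k) * s ^+ k) *
        cabs (z - z') ^+ 2); last by ring.
      by rewrite [leRHS]mulrAC ler_wpM2r ?exprn_ge0 ?cabs_ge0.
    rewrite -mulr_sumr mulrC -mulrA ler_wpM2r ?mulr_ge0 ?exprn_ge0 ?cabs_ge0//.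
    exact: halfpow_sum.
  rewrite (_ : g z - g z' - G z' * (z - z') = (S1 - S2 - S3 * (z - z')) -
     ((S1 - g z) - (S2 - g z') - (S3 - G z') * (z - z'))); last by ring.
  apply: le_trans (ler_wpM2l (exprn_ge0 2 (ltW s0)) (cabsD _ _)) _.
  rewrite mulrDr lerD// cabsN -ler_pdivlMl ?exprn_gt0//.
  apply: le_trans (cabsD _ _) _; rewrite cabsN cabsM.
  apply: (@le_trans _ _ (e / K + e / K + e / K * cabs (z - z'))).
    rewrite lerD ?ler_wpM2r ?cabs_ge0 ?(ltW H3)//.
    by apply: le_trans (cabsD _ _) _; rewrite cabsN lerD// ltW.
  rewrite le_eqVlt; apply/orP; left; apply/eqP.
  rewrite /K; field; rewrite lt0r_neq0//= lt0r_neq0//.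
  by rewrite ltr_pwDl// cabs_ge0.
exists G => z' /discE z's; split; last exact: HG.
apply/cderiv_epsP => e e0.
pose d := Num.min (s - cabs (z' - w)) (e * s ^+ 2 / (2 * M + 1)).
have M1 : 0 < 2 * M + 1 by rewrite ltr_pwDr// mulr_ge0.
have d0 : 0 < d by rewrite lt_min subr_gt0 z's /= divr_gt0// mulr_gt0// exprn_gt0.
apply/nbhsCP; exists d => // z; rewrite lt_min => /andP[h1 h2].
have zs : cabs (z - w) < s.
  by apply: le_lt_trans (cabs_triangle z' _ _) _; rewrite -ltrBrDr.
have := quad _ _ zs z's; rewrite -ler_pdivlMl ?exprn_gt0// => /le_trans; apply.
rewrite ler_pdivrMl ?exprn_gt0// expr2 !mulrA; apply: ler_wpM2r; first exact: cabs_ge0.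
apply: (@le_trans _ _ ((2 * M + 1) * cabs (z - z'))).
  by apply: ler_wpM2r; rewrite ?cabs_ge0// lerDl.
by rewrite mulrC -ler_pdivlMr// [s ^+ 2 * e]mulrC ltW.
Qed.

(** The derivative is again given by power series, with a smaller radius
    around each point, so the argument can be iterated. *)
Lemma analytic_smooth (U : set C) (f : C -> C) :
  open_set U -> analytic_on U f -> smooth U f.
Proof.
move=> oU fa n; elim: n f fa => // n IH f fa.
have dU : analytic_on U (derive1 f) /\ deriv_on U f (derive1 f).
  split=> w Uw; have [r r0 [a ha]] := fa w Uw;
    have [G HG] := power_series_derivative r0 ha.
    exists (r / 16); first by rewrite divr_gt0.
    exists (fun k => k.+1%:R * a k.+1) => z /HG[dz].
    by rewrite (cderiv_derive1 dz).
  have [|dw _] := HG w; last by rewrite (cderiv_derive1 dw).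
  by apply/discE; rewrite subrr cabs0 divr_gt0.
by exists (derive1 f); [exact: dU.2|exact: IH dU.1].
Qed.

End PowerSeries.

(** * Contour integrals *)

Section ContourIntegral.
Context {R : realType}.
Local Notation C := R[i].
Implicit Types (g : R -> C) (h k F : C -> C) (G : seq (seq (R -> C))).

Lemma arc_integralE g h :
  arc_integral g h = cint (fun t => h (g t) * velocity g t).
Proof. by []. Qed.

Lemma C1_arc_rderiv g (t : R) : C1_arc g -> rderiv g t (velocity g t).
Proof.
move=> [dR dI _ _]; apply/rderivP; split.
  by rewrite /velocity /= derive1E; split => //; exact: dR.
by rewrite /velocity /= derive1E; split => //; exact: dI.
Qed.

Lemma C1_arc_cont01 g : C1_arc g -> cont01 g.
Proof.
move=> ga t _; apply: slope_continuous (C1_arc_rderiv t ga).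
exact: tends_real_complex.
Qed.

Lemma velocity_cont01 g : C1_arc g -> cont01 (velocity g).
Proof. by move=> [_ _ cR cI] t _; apply: tends_ReIm; [exact: cR|exact: cI]. Qed.

Lemma arc_integral_exact (U : set C) F h g : C1_arc g ->
  deriv_on U F h -> continuous_on U h ->
  (forall t, 0 <= t <= 1 -> U (g t)) ->
  arc_integral g h = F (g 1) - F (g 0).
Proof.
move=> ga dF hc gU; rewrite arc_integralE (@cint_FTC _ (fun t => F (g t)))//.
  move=> t t01; apply: rderiv_comp; first exact: C1_arc_rderiv.
  by apply: dF; exact: gU.
apply: cont01M; last exact: velocity_cont01.
by apply: cont01_comp; [exact: C1_arc_cont01|move=> t /gU; exact: hc].
Qed.

Lemma arc_of_contour G g : contour G -> g \in flatten G ->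
  C1_arc g /\ forall t, 0 <= t <= 1 -> support_of G (g t).
Proof.
move=> cG gG; split; last by move=> t t01; exists g => //; exists t.
by move/flattenP : gG => [p pG gp]; case: (cG p pG) => _; exact.
Qed.

Lemma eq_contour_integral G h k : (forall z, support_of G z -> h z = k z) ->
  contour_integral G h = contour_integral G k.
Proof.
move=> hk; rewrite /contour_integral big_seq [RHS]big_seq.
apply: eq_bigr => g gG; rewrite !arc_integralE; apply: eq_cint => t t01.
by rewrite hk//; exists g => //; exists t.
Qed.

Let integrand G g h : contour G -> g \in flatten G ->
  continuous_on (support_of G) h -> cont01 (fun t => h (g t) * velocity g t).
Proof.
move=> cG gG hc; have [ga gs] := arc_of_contour cG gG.
apply: cont01M; last exact: velocity_cont01.
by apply: cont01_comp; [exact: C1_arc_cont01|move=> t /gs; exact: hc].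
Qed.

Lemma contour_integralD G h k : contour G ->
  continuous_on (support_of G) h -> continuous_on (support_of G) k ->
  contour_integral G (fun z => h z + k z) =
  contour_integral G h + contour_integral G k.
Proof.
move=> cG hc kc; rewrite /contour_integral -big_split /= !big_seq.
apply: eq_bigr => g gG; rewrite !arc_integralE -cintD; last 2 first.
- exact: integrand hc.
- exact: integrand kc.
by apply: eq_cint => t _; rewrite mulrDl.
Qed.

Lemma contour_integralZ G c h : contour G ->
  continuous_on (support_of G) h ->
  contour_integral G (fun z => c * h z) = c * contour_integral G h.
Proof.
move=> cG hc; rewrite /contour_integral mulr_sumr !big_seq.
apply: eq_bigr => g gG; rewrite !arc_integralE -cintZ; last exact: integrand hc.
by apply: eq_cint => t _; rewrite mulrA.
Qed.

Lemma contour_integral0 G : contour_integral G (fun=> 0) = 0.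
Proof.
rewrite /contour_integral big1// => g _.
by rewrite arc_integralE -[RHS]cint_cst; apply: eq_cint => t _; rewrite mul0r.
Qed.

Lemma continuous_on_sum (I : Type) (r : seq I) (U : set C) (h : I -> C -> C) :
  (forall i, continuous_on U (h i)) ->
  continuous_on U (fun z => \sum_(i <- r) h i z).
Proof. by move=> hc z Uz; apply: tends_sum => i; exact: hc. Qed.

Lemma contour_integral_sum (I : Type) (r : seq I) G (h : I -> C -> C) :
  contour G -> (forall i, continuous_on (support_of G) (h i)) ->
  contour_integral G (fun z => \sum_(i <- r) h i z) =
  \sum_(i <- r) contour_integral G (h i).
Proof.
move=> cG hc; elim: r => [|i r IH].
  rewrite big_nil -[RHS](contour_integral0 G).
  by apply: eq_contour_integral => z _; rewrite big_nil.
rewrite big_cons -IH -contour_integralD//; last exact: continuous_on_sum.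
by apply: eq_contour_integral => z _; rewrite big_cons.
Qed.

Lemma closed_path_telescope F (p : seq (R -> C)) :
  cycle (fun g h : R -> C => g 1 == h 0) p ->
  \sum_(g <- p) (F (g 1) - F (g 0)) = 0.
Proof.
have aux q x : path (fun g h : R -> C => g 1 == h 0) x q ->
    \sum_(g <- x :: q) (F (g 1) - F (g 0)) = F ((last x q) 1) - F (x 0).
  elim: q x => [|y q IH] x /=; first by rewrite big_seq1.
  by move=> /andP[/eqP xy /IH]; rewrite big_cons => ->; rewrite xy; ring.
case: p => [|x q] /=; first by rewrite big_nil.
rewrite rcons_path => /andP[/aux -> /eqP ->]; exact: subrr.
Qed.

(** On each arc the integral is an increment of F, and the increments along a
    closed path add up to 0. *)
Lemma contour_integral_exact (U : set C) F h G : contour G ->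
  support_of G `<=` U -> deriv_on U F h -> continuous_on U h ->
  contour_integral G h = 0.
Proof.
move=> cG GU dF hc; rewrite /contour_integral.
transitivity (\sum_(g <- flatten G) (F (g 1) - F (g 0))).
  rewrite big_seq [RHS]big_seq; apply: eq_bigr => g gG.
  have [ga gs] := arc_of_contour cG gG.
  by apply: (arc_integral_exact ga dF hc) => t t01; exact: GU (gs t t01).
rewrite big_flatten /= big_seq big1// => p pG.
by apply: closed_path_telescope; case: (cG p pG).
Qed.

End ContourIntegral.

(** * Contour integrals of rational functions *)

Section Rational.
Context {R : realType}.
Local Notation C := R[i].
Implicit Types (G : seq (seq (R -> C))) (p q u v : {poly C}) (s : seq C).

Lemma twopii_neq0 : (twopii : C) != 0.
Proof.
rewrite /twopii eq_complex /= negb_and mulf_neq0 ?orbT// ?pnatr_eq0//.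
by rewrite gt_eqF// pi_gt0.
Qed.

Lemma continuous_on_sub (U V : set C) (f : C -> C) : V `<=` U ->
  continuous_on U f -> continuous_on V f.
Proof. by move=> VU fc z /VU; exact: fc. Qed.

Lemma continuous_onM (U : set C) (f g : C -> C) :
  continuous_on U f -> continuous_on U g -> continuous_on U (fun z => f z * g z).
Proof. by move=> fc gc z Uz; apply: tendsM; [exact: fc|exact: gc]. Qed.

Lemma smooth_poly (U : set C) p : smooth U (horner p).
Proof. by move=> n; exact: diff_times_horner. Qed.

Lemma smooth_rational u v :
  smooth [set z | v.[z] != 0] (fun z => u.[z] / v.[z]).
Proof.
move=> n; apply: diff_timesM; first exact: diff_times_horner.
by apply: diff_timesV; [move=> z|exact: diff_times_horner].
Qed.

Lemma rational_continuous (U : set C) u v : (forall z, U z -> v.[z] != 0) ->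
  continuous_on U (fun z => u.[z] / v.[z]).
Proof.
move=> Uv; apply: (continuous_on_sub (U := [set z | v.[z] != 0])) => //.
exact: smooth_continuous (smooth_rational u v).
Qed.

Lemma open_nonroot v : open_set [set z | v.[z] != 0].
Proof.
move=> z /= vz; have vc := smooth_continuous (smooth_poly setT v) (z := z) I.
have e0 : 0 < cabs v.[z] by rewrite cabs_gt0.
apply: filterS (vc _ e0) => w /=; apply: contraTneq => ->.
by rewrite sub0r cabsN ltxx.
Qed.

Lemma inverse_continuous (U : set C) v : (forall z, U z -> v.[z] != 0) ->
  continuous_on U (fun z => v.[z]^-1).
Proof.
move=> Uv; rewrite (_ : (fun z => _) = fun z => (1 : {poly C}).[z] / v.[z]).
  exact: rational_continuous.
by apply/funext => z; rewrite hornerE mul1r.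
Qed.

Definition prod_XsubC s : {poly C} := \prod_(a <- s) ('X - a%:P).

Lemma prod_XsubC_cons a s z :
  (prod_XsubC (a :: s)).[z] = (z - a) * (prod_XsubC s).[z].
Proof. by rewrite /prod_XsubC big_cons hornerM hornerXsubC. Qed.

Lemma prod_XsubC_neq0 s z : ((prod_XsubC s).[z] != 0) = (z \notin s).
Proof. by rewrite -[_ == 0]/(root _ z) root_prod_XsubC. Qed.

Lemma contour_integral_poly G p : contour G -> contour_integral G (horner p) = 0.
Proof.
move=> cG.
have pw k : contour_integral G (fun z => z ^+ k) = 0.
  apply: (@contour_integral_exact _ setT (fun z => k.+1%:R^-1 * z ^+ k.+1)) => //.
    move=> z _; have idz := @tends_id R z.
    have := slopeZ idz k.+1%:R^-1 (slopeX idz k.+1 (slope_id id z)).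
    by rewrite mulr1 /= mulrA mulVf ?mul1r// pnatr_eq0.
  move=> z _; have := smooth_continuous (smooth_poly setT 'X^k).
  rewrite (_ : horner 'X^k = fun z => z ^+ k); first exact.
  by apply/funext => w; rewrite hornerXn.
rewrite (@eq_contour_integral _ _ _ (fun z => \sum_(i < size p) p`_i * z ^+ i)).
  have cX k : continuous_on (support_of G) (fun z => z ^+ k).
    move=> z _; have := smooth_continuous (smooth_poly setT 'X^k).
    rewrite (_ : horner 'X^k = fun z => z ^+ k); first exact.
    by apply/funext => w; rewrite hornerXn.
  rewrite contour_integral_sum//; last first.
    by move=> i; apply: continuous_onM => // z _; exact: tends_cst.
  by rewrite big1// => i _; rewrite contour_integralZ// pw mulr0.
by move=> z _; rewrite horner_coef.
Qed.

Lemma contour_integral_pole G a k : contour G -> ~ support_of G a ->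
  contour_integral G (fun z => ((z - a)^-1) ^+ k.+2) = 0.
Proof.
move=> cG Ga; pose U := [set z : C | z != a].
have GU : support_of G `<=` U by move=> z Gz; apply/eqP => za; apply: Ga; rewrite -za.
have dinv z : U z -> cderiv (fun z => (z - a)^-1) z (- (z - a)^-1 ^+ 2).
  move=> Uz; have z0 : z - a != 0 by rewrite subr_eq0.
  have := slope_comp (@tends_id R z)
    (slopeB (slope_id id z) (slope_cst id z a)) (cderiv_inv z0).
  by rewrite subr0 mulr1.
apply: (@contour_integral_exact _ U (fun z => - k.+1%:R^-1 * (z - a)^-1 ^+ k.+1)) => //.
  move=> z Uz; have idz := @tends_id R z.
  have := slopeZ idz (- k.+1%:R^-1) (slopeX idz k.+1 (dinv z Uz)).
  apply: slope_eq; have k0 : (k.+1%:R : C) != 0 by rewrite pnatr_eq0.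
  move: (z - a)^-1 => w; rewrite -[k.+2]addn2 exprD exprS /=.
  by move: (w ^+ k) => wk; field.
move=> z Uz.
have dX := slopeX (@tends_id R z) k.+2 (dinv z Uz).
exact: (slope_continuous (@tends_id R z) dX).
Qed.

(** Partial fractions. If s contains two distinct points a and b, then 1 / ((z
    - a)(z - b)) = (1 / (z - a) - 1 / (z - b)) / (a - b), and by induction
    both terms have the same integral because the winding numbers agree. If
    all points of s coincide, the integrand has a primitive as soon as there
    are two of them. *)
Lemma contour_integral_inv_prod G s (om : C) : contour G ->
  (forall a, a \in s -> ~ support_of G a) ->
  (forall a, a \in s -> winding G a = om) ->
  contour_integral G (fun z => (prod_XsubC s).[z]^-1) =
  if size s == 1%N then twopii * om else 0.
Proof.
move=> cG; have [n] := ubnP (size s); elim: n s => // n IH s.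
have cinv s' : (forall a, a \in s' -> ~ support_of G a) ->
    continuous_on (support_of G) (fun z => (prod_XsubC s').[z]^-1).
  move=> s'G; apply: inverse_continuous => z Gz.
  by rewrite prod_XsubC_neq0; apply/negP => /s'G; exact.
case: s => [|a s] sn sG sw.
  rewrite (@eq_contour_integral _ _ _ (horner (1 : {poly C}))).
    exact: contour_integral_poly.
  by move=> z _; rewrite /prod_XsubC big_nil hornerE invr1.
have [/allP sa|/allPn[b bs ba]] := boolP (all (pred1 a) s).
  rewrite (@eq_contour_integral _ _ _ (fun z => (z - a)^-1 ^+ (size s).+1)); last first.
    move=> z _; rewrite exprVn; congr (_^-1).
    rewrite prod_XsubC_cons exprS; congr (_ * _).
    elim: s sa {sn sG sw} => [|b s IHs] sa; first by rewrite /prod_XsubC big_nil hornerE.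
    rewrite prod_XsubC_cons IHs ?exprS; last first.
      by move=> c cs; apply: sa; rewrite inE cs orbT.
    by rewrite (eqP (sa b _)) ?mem_head.
  case: s {sa sn} sG sw => [|b s] sG sw /=.
    rewrite -(sw a) ?mem_head// /winding mulrA mulfV ?mul1r ?twopii_neq0//.
  by apply: contour_integral_pole => //; apply: sG; exact: mem_head.
have sne : size s != 0%N by case: (s) bs.
rewrite /= (_ : ((size s).+1 == 1%N) = false); last first.
  by rewrite eqSS; exact: negbTE.
pose t := rem b s; have st : perm_eq s (b :: t) by exact: perm_to_rem.
have ab : a - b != 0 by rewrite subr_eq0 eq_sym.
have sz : size s = (size t).+1 by rewrite (perm_size st).
have tG c : c \in t -> c \in a :: s.
  by move=> ct; rewrite inE (perm_mem st) inE ct !orbT.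
have bG : b \in a :: s by rewrite inE bs orbT.
have Ea : forall c, c \in a :: t -> c \in a :: s.
  by move=> c; rewrite inE => /predU1P[->|/tG//]; rewrite mem_head.
have Eb : forall c, c \in b :: t -> c \in a :: s.
  by move=> c; rewrite inE => /predU1P[->//|/tG].
have IHa := IH (a :: t) _ (fun c ct => sG c (Ea c ct)) (fun c ct => sw c (Ea c ct)).
have IHb := IH (b :: t) _ (fun c ct => sG c (Eb c ct)) (fun c ct => sw c (Eb c ct)).
have tn : ((size t).+1 < n)%N by rewrite -sz -ltnS.
rewrite (@eq_contour_integral _ _ _ (fun z => (a - b)^-1 * (prod_XsubC (a :: t)).[z]^-1 +
  - (a - b)^-1 * (prod_XsubC (b :: t)).[z]^-1)).
  have ca := cinv (a :: t) (fun c ct => sG c (Ea c ct)).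
  have cb := cinv (b :: t) (fun c ct => sG c (Eb c ct)).
  have cc (c : C) : continuous_on (support_of G) (fun=> c).
    by move=> z _; exact: tends_cst.
  rewrite contour_integralD//; [|exact: continuous_onM|exact: continuous_onM].
  by rewrite !contour_integralZ// IHa// IHb// -mulrDl subrr mul0r.
move=> z Gz.
have za : z - a != 0.
  by rewrite subr_eq0; apply/eqP => E; apply: (sG a); rewrite ?mem_head// -E.
have zb : z - b != 0.
  by rewrite subr_eq0; apply/eqP => E; apply: (sG b); rewrite // -E.
rewrite /prod_XsubC !big_cons (perm_big _ st) /= big_cons !hornerM !hornerXsubC.
have : (\prod_(c <- t) ('X - c%:P)).[z] != 0.
  by rewrite prod_XsubC_neq0; apply/negP => /tG /sG; exact.
move: (_.[z]) => w w0; field.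
by rewrite w0 zb za ab.
Qed.

(** At a root b of the denominator, u = u(b) + (z - b) u1, which leaves the
    integral of a constant over the denominator, equal to 0 by
    contour_integral_inv_prod, and a quotient with one root less. *)
Lemma contour_integral_rational0 G u v : contour G -> v != 0 ->
  (forall a, root v a -> ~ support_of G a) ->
  (forall a, root v a -> winding G a = 0) ->
  contour_integral G (fun z => u.[z] / v.[z]) = 0.
Proof.
move=> cG v0; have [s vE] := closed_field_poly_normal v.
have l0 : lead_coef v != 0 by rewrite lead_coef_eq0.
have rs a : root v a = (a \in s) by rewrite vE rootZ// root_prod_XsubC.
move=> rG rw.
have sG a : a \in s -> ~ support_of G a by rewrite -rs; exact: rG.
have sw a : a \in s -> winding G a = 0 by rewrite -rs; exact: rw.
have nz s' : (forall a, a \in s' -> a \in s) ->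
    forall z, support_of G z -> (prod_XsubC s').[z] != 0.
  by move=> s's z Gz; rewrite prod_XsubC_neq0; apply/negP => /s's/sG; exact.
have H : forall s' u, (forall a, a \in s' -> a \in s) ->
    contour_integral G (fun z => u.[z] / (prod_XsubC s').[z]) = 0.
  elim=> [|b s' IH] {}u s's.
    rewrite (@eq_contour_integral _ _ _ (horner u)).
      exact: contour_integral_poly.
    by move=> z _; rewrite /prod_XsubC big_nil [(1 : {poly C}).[z]]hornerE invr1 mulr1.
  have s's' a : a \in s' -> a \in s by move=> h; apply: s's; rewrite inE h orbT.
  have : root (u - u.[b]%:P) b by rewrite /root hornerD hornerN hornerC subrr.
  move=> /factor_theorem[u1 u1E].
  have uE z : u.[z] = u.[b] + u1.[z] * (z - b).
    have := congr1 (horner^~ z) u1E.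
    by rewrite /= hornerM hornerXsubC hornerD hornerN hornerC => <-; ring.
  rewrite (@eq_contour_integral _ _ _ (fun z =>
     u.[b] * (prod_XsubC (b :: s')).[z]^-1 + u1.[z] / (prod_XsubC s').[z])).
    rewrite contour_integralD//; last 2 first.
    - apply: continuous_onM; first by move=> z _; exact: tends_cst.
      exact/inverse_continuous/nz.
    - exact/rational_continuous/nz.
    rewrite contour_integralZ//; last exact/inverse_continuous/nz.
    rewrite IH// addr0 (@contour_integral_inv_prod _ _ 0)//.
    - by rewrite mulr0 if_same mulr0.
    - by move=> a /s's/sG.
    - by move=> a /s's/sw.
  move=> z Gz; have z1 := nz _ s's z Gz; have z2 := nz _ s's' z Gz.
  rewrite uE; move: z1 z2; rewrite prod_XsubC_cons.
  by rewrite mulf_eq0 negb_or => /andP[z1 _] z2; field; rewrite z1 z2.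
rewrite (@eq_contour_integral _ _ _ (fun z =>
  (lead_coef v)^-1 * (u.[z] / (prod_XsubC s).[z]))).
  rewrite contour_integralZ//; first by rewrite H// mulr0.
  by apply/rational_continuous/nz.
by move=> z _; rewrite {1}vE hornerZ invfM mulrCA.
Qed.

End Rational.

(** * The resolvent *)

Section Resolvent.
Context {R : realType} {n : nat}.
Local Notation C := R[i].
Implicit Types (G : seq (seq (R -> C))) (p q : {poly C}) (B : 'M[C]_n.+1).

Lemma char_poly_horner B z : (char_poly B).[z] = \det (z%:M - B).
Proof.
rewrite /char_poly -[_.[z]]/(horner_eval z _) -det_map_mx.
congr (\det _); apply/matrixP => i j.
rewrite !mxE /= /horner_eval hornerD hornerN hornerC.
by case: (i == j); rewrite ?mulr1n ?mulr0n ?hornerX ?hornerC.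
Qed.

Lemma char_poly_split B : exists2 r : seq C,
  char_poly B = prod_XsubC r & forall a, spectrum B a <-> a \in r.
Proof.
have [r rE] := closed_field_poly_normal (char_poly B).
have lead1 : lead_coef (char_poly B) = 1 by exact/monicP/char_poly_monic.
rewrite lead1 scale1r in rE; exists r => // a.
by rewrite /spectrum /= eigenvalue_root_char rE root_prod_XsubC.
Qed.

Lemma notin_spectrum B z : ~ spectrum B z -> (char_poly B).[z] != 0.
Proof.
by move=> /negP; rewrite eigenvalue_root_char.
Qed.

Definition adj_char_poly B i j : {poly C} := (\adj (char_poly_mx B)) i j.

Lemma adj_char_poly_horner B i j z :
  (adj_char_poly B i j).[z] = (\adj (z%:M - B)) i j.
Proof.
rewrite /adj_char_poly -[_.[z]]/(horner_eval z _).
transitivity ((map_mx (horner_eval z) (\adj (char_poly_mx B))) i j).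
  by rewrite [RHS]mxE.
rewrite map_mx_adj; congr ((\adj _) i j); apply/matrixP => k l.
rewrite !mxE /= /horner_eval hornerD hornerN hornerC.
by case: (k == l); rewrite ?mulr1n ?mulr0n ?hornerX ?hornerC.
Qed.

Lemma resolvent_unit B z : ~ spectrum B z -> (z%:M - B) \in unitmx.
Proof.
by move=> /notin_spectrum; rewrite char_poly_horner unitmxE unitfE.
Qed.

Lemma resolventE B z i j : ~ spectrum B z ->
  invmx (z%:M - B) i j = (adj_char_poly B i j).[z] / (char_poly B).[z].
Proof.
move=> zB; rewrite /invmx resolvent_unit// mxE adj_char_poly_horner.
by rewrite char_poly_horner mulrC.
Qed.

Lemma resolvent_continuous B (U : set C) i j : (forall z, U z -> ~ spectrum B z) ->
  continuous_on U (fun z => invmx (z%:M - B) i j).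
Proof.
move=> UB z Uz; have cf := @rational_continuous _ [set z | (char_poly B).[z] != 0]
  (adj_char_poly B i j) (char_poly B) (fun z h => h).
have Kz : (char_poly B).[z] != 0 by apply: notin_spectrum; exact: UB.
have nz := open_nonroot Kz.
move=> e e0; rewrite resolventE; last exact: UB.
apply: filterS2 nz (cf z Kz e e0) => w w0.
by rewrite resolventE//; apply/negP; rewrite eigenvalue_root_char.
Qed.

(** The Newton expansion of the resolvent along a sequence of points s_k; it
    telescopes because z - B = (z - s_k) - (B - s_k). *)
Lemma newton_resolvent B z (s : nat -> C) m :
  (forall k, (k < m)%N -> z != s k) ->
  (z%:M - B) * \sum_(k < m) ((\prod_(i < k.+1) (z - s i))^-1 *:
                             \prod_(i < k) (B - (s i)%:M)) =
  1 - (\prod_(i < m) (z - s i))^-1 *: \prod_(i < m) (B - (s i)%:M).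
Proof.
elim: m => [|m IH] zs.
  by rewrite !big_ord0 mulr0 invr1 scale1r subrr.
rewrite big_ord_recr /= mulrDr IH; last by move=> k km; apply: zs; exact: leqW.
rewrite [\prod_(i < m.+1) (B - _)]big_ord_recr /=.
rewrite [\prod_(i < m.+1) (z - _)]big_ord_recr /=.
have zm : z - s m != 0 by rewrite subr_eq0 zs.
set N := \prod_(i < m) (B - _); set P := \prod_(i < m) (z - _).
have NB : N * B = B * N.
  symmetry; apply: commr_prod => i _; apply: commrB; first exact: commr_refl.
  exact: scalar_mxC.
have zN : z%:M * N = z *: N by exact: mul_scalar_mx.
have Ns : N * (s m)%:M = s m *: N by exact: mul_mx_scalar.
rewrite -scalerAr mulrBl zN [N * _]mulrBr Ns NB -addrA; congr (_ + _).
rewrite invfM -scalerA [LHS]addrC -scalerN -scalerN.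
have -> : z *: N - B * N = (z - s m) *: N - (B * N - s m *: N).
  by rewrite scalerBl opprB addrA subrK.
have -> : P^-1 *: - N = (P^-1 * (z - s m)^-1) *: - ((z - s m) *: N).
  by rewrite -scalerN scalerA -mulrA mulVf// mulr1.
by rewrite scalerA -scalerDr addrAC subrr add0r.
Qed.

Section Enclosed.
Variables (B : 'M[C]_n.+1) (U : set C) (G : seq (seq (R -> C))).
Hypothesis encl : encloses G (spectrum B) U.

Let cG : contour G. Proof. by case: encl. Qed.
Let GB z : support_of G z -> ~ spectrum B z.
Proof. by case: encl => _ GU _ _ /GU[]. Qed.

Let resc i j : continuous_on (support_of G) (fun z => invmx (z%:M - B) i j).
Proof. exact: resolvent_continuous. Qed.

Let pc p : continuous_on (support_of G) (horner p).
Proof. exact: smooth_continuous (smooth_poly _ p). Qed.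

Let cstc (c : C) : continuous_on (support_of G) (fun=> c).
Proof. by move=> z _; exact: tends_cst. Qed.

(** Along an enumeration of the eigenvalues the remainder of the Newton
    expansion vanishes by the Cayley-Hamilton theorem. Of its terms, only the
    first has a single factor in the denominator, and the integrals of the
    others are 0. *)
Lemma contour_integral_resolvent i j :
  contour_integral G (fun z => invmx (z%:M - B) i j) = twopii * (i == j)%:R.
Proof.
have [r rE rB'] := char_poly_split B.
have rB a : a \in r -> spectrum B a by move/rB'.
have szr : size r = n.+1.
  by have := size_char_poly B; rewrite rE /prod_XsubC size_prod_XsubC => -[].
pose s k := nth 0 r k.
pose t k : seq C := [seq s i | i <- iota 0 k].
have tprod k z : \prod_(i < k) (z - s i) = (prod_XsubC (t k)).[z].
  rewrite /prod_XsubC horner_prod big_map (_ : iota 0 k = index_iota 0 k); last first.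
    by rewrite /index_iota subn0.
  rewrite big_mkord.
  by apply: eq_bigr => l _; rewrite hornerXsubC.
have tr k a : (k <= n.+1)%N -> a \in t k -> a \in r.
  move=> kn /mapP[l]; rewrite mem_iota add0n /= => lk ->.
  by apply: mem_nth; rewrite szr (leq_trans lk).
have kill : \prod_(i < n.+1) (B - (s i)%:M) = 0.
  have := Cayley_Hamilton B; rewrite rE /prod_XsubC rmorph_prod /= => <-.
  rewrite [RHS](big_nth 0) szr [RHS]big_mkord; apply: eq_bigr => l _.
  by rewrite rmorphB /= horner_mx_X horner_mx_C.
have E z : support_of G z -> invmx (z%:M - B) i j =
    \sum_(k < n.+1) (\prod_(i < k) (B - (s i)%:M)) i j * (prod_XsubC (t k.+1)).[z]^-1.
  move=> Gz; have zr k : (k < n.+1)%N -> z != s k.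
    move=> kn; apply/eqP => zk; apply: (GB Gz); apply: rB.
    by rewrite zk; apply: mem_nth; rewrite szr.
  have := newton_resolvent B zr; rewrite kill scaler0 subr0.
  set S := \sum_(k < _) _ => BS.
  have -> : invmx (z%:M - B) = S.
    by rewrite -[LHS]mulmx1 -[1%:M]BS mulKmx// resolvent_unit//; exact: GB.
  rewrite /S summxE; apply: eq_bigr => k _.
  by rewrite mxE tprod mulrC.
rewrite (eq_contour_integral E).
have tG k a : (k <= n.+1)%N -> a \in t k -> ~ support_of G a.
  by move=> kn /(tr _ _ kn)/rB aB /GB.
have ctn (k : 'I_n.+1) : continuous_on (support_of G)
    (fun z => (\prod_(i < k) (B - (s i)%:M)) i j * (prod_XsubC (t k.+1)).[z]^-1).
  apply: continuous_onM => //.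
  apply: inverse_continuous => z Gz.
  by rewrite prod_XsubC_neq0; apply/negP => /tG; apply.
rewrite contour_integral_sum// big_ord_recl [X in _ + X]big1 ?addr0 => [|k _].
  rewrite contour_integralZ//; last first.
    apply: inverse_continuous => z Gz.
    by rewrite prod_XsubC_neq0; apply/negP => /tG; apply.
  rewrite (@contour_integral_inv_prod _ _ _ 1)//.
  - have -> : \prod_(l < (ord0 : 'I_n.+1)) (B - (s l)%:M) = 1 by exact: big_ord0.
    by rewrite /= mulr1 mxE mulrC.
  - by move=> a; exact: tG.
  - by move=> a at1; case: encl => _ _ w1 _; apply/w1/rB; exact: tr at1.
rewrite contour_integralZ//; last first.
  apply: inverse_continuous => z Gz.
  by rewrite prod_XsubC_neq0; apply/negP => /tG; apply.
rewrite (@contour_integral_inv_prod _ _ _ 1)//.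
- by rewrite size_map size_iota /= mulr0.
- by move=> a; apply: tG.
- by move=> a atk; case: encl => _ _ w1 _; apply/w1/rB; apply: tr atk.
Qed.

(** Induction on p from z (z - B)^-1 = 1 + B (z - B)^-1. *)
Lemma contour_integral_poly_resolvent p i j :
  contour_integral G (fun z => p.[z] * invmx (z%:M - B) i j) =
  twopii * horner_mx B p i j.
Proof.
elim/poly_ind: p i j => [|p c IH] i j.
  rewrite rmorph0 mxE mulr0 -[RHS](contour_integral0 G).
  by apply: eq_contour_integral => z _; rewrite horner0 mul0r.
rewrite (@eq_contour_integral _ _ _ (fun z => ((i == j)%:R * p.[z] +
   \sum_k B i k * (p.[z] * invmx (z%:M - B) k j)) +
   c * invmx (z%:M - B) i j)); last first.
  move=> z Gz; rewrite hornerMXaddC mulrDl; congr (_ + _).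
  have : ((z%:M - B) *m invmx (z%:M - B)) i j = (i == j)%:R.
    by rewrite mulmxV ?resolvent_unit ?mxE//; exact: GB.
  rewrite mulmxBl mul_scalar_mx !mxE => <-.
  rewrite mulrBl -mulrA mulr_suml.
  under [X in _ = _ - X + _]eq_bigr do rewrite -mulrA [_ * p.[z]]mulrC.
  by rewrite subrK mulrC.
have psc k : continuous_on (support_of G) (fun z => p.[z] * invmx (z%:M - B) k j).
  exact: continuous_onM.
have sc : continuous_on (support_of G)
    (fun z => \sum_k B i k * (p.[z] * invmx (z%:M - B) k j)).
  by apply: continuous_on_sum => k; exact: continuous_onM.
have dc : continuous_on (support_of G) (fun z => (i == j)%:R * p.[z]).
  exact: continuous_onM.
rewrite contour_integralD//; last 2 first.
- by move=> z Gz; apply: tendsD; [exact: dc|exact: sc].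
- exact: continuous_onM.
rewrite contour_integralD// !contour_integralZ// contour_integral_poly// mulr0 add0r.
rewrite contour_integral_sum//; last by move=> k; exact: continuous_onM.
rewrite contour_integral_resolvent rmorphD rmorphM /= horner_mx_X horner_mx_C.
rewrite mxE mulrDr; congr (_ + _); last first.
  by rewrite mxE; case: (i == j); rewrite ?mulr1 ?mulr1n ?mulr0 ?mulr0n ?mulr0// mulrC.
rewrite -[horner_mx B p * B]/(horner_mx B p *m B).
have -> : horner_mx B p *m B = B *m horner_mx B p.
  by apply/comm_horner_mx/comm_mx_refl.
rewrite mxE mulr_sumr; apply: eq_bigr => k _.
by rewrite contour_integralZ// IH mulrCA.
Qed.

(** The characteristic polynomial times the resolvent is the adjugate of z -
    B, whose entries are polynomial in z; hence the second term of g
    contributes nothing. *)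
Lemma resolvent_integral_poly (g h : C -> C) p :
  (forall z, U z -> g z = p.[z] + (char_poly B).[z] * h z) ->
  continuous_on U h ->
  (forall q, contour_integral G (fun z => h z * q.[z]) = 0) ->
  resolvent_integral G g B = horner_mx B p.
Proof.
move=> gE hc h0; apply/matrixP => i j; rewrite !mxE.
have GU z : support_of G z -> U z by case: encl => _ GU _ _ /GU[].
have hcG := continuous_on_sub GU hc.
rewrite (@eq_contour_integral _ _ _ (fun z => p.[z] * invmx (z%:M - B) i j +
   h z * (adj_char_poly B i j).[z])); last first.
  move=> z Gz; rewrite gE; last exact: GU.
  rewrite mulrDl; congr (_ + _); rewrite resolventE; last exact: GB.
  have := notin_spectrum (GB Gz); move: (_.[z]) (_.[z]) (h z) => a b hz b0.
  by field.
rewrite contour_integralD//; [|exact: continuous_onM|exact: continuous_onM].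
rewrite h0 addr0 contour_integral_poly_resolvent mulrA mulVf ?mul1r//.
exact: twopii_neq0.
Qed.

End Enclosed.

Lemma matfun_eq (U : set C) g B (F : 'M[C]_n.+1) :
  (exists G, encloses G (spectrum B) U) ->
  (forall G, encloses G (spectrum B) U -> resolvent_integral G g B = F) ->
  matfun U g B = F.
Proof.
move=> [G0 eG0] HF; rewrite /matfun.
have [G eG ->] := xgetPex (0 : 'M[C]_n.+1) (P := [set F | exists2 G,
   encloses G (spectrum B) U & F = resolvent_integral G g B])
   (ex_intro _ _ (ex_intro2 _ _ G0 eG0 erefl)).
exact: HF.
Qed.

End Resolvent.

(** * Existence of enclosing contours *)

Section Circles.
Context {R : realType}.
Local Notation C := R[i].
Implicit Types (c a : C) (s : R).

Definition circle c s (t : R) : C :=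
  (complex.Re c + s * cos (2 * pi * t)) +i* (complex.Im c + s * sin (2 * pi * t)).

Lemma continuous_rescale (g : R -> R) (k s t : R) :
  {for k * t, continuous g} -> {for t, continuous (fun u => s * (k * g (k * u)))}.
Proof.
move=> gc; have gk : {for t, continuous (fun u => g (k * u))}.
  exact: (continuous_comp (@mulrl_continuous R k t) gc).
have H1 := continuous_comp gk (@mulrl_continuous R k _).
exact: (continuous_comp H1 (@mulrl_continuous R s _)).
Qed.

Lemma is_derive_affine_comp (f f' : R -> R) (x k t s : R) :
  (forall y : R, is_derive y (1 : R) f (f' y)) ->
  is_derive t (1 : R) (fun t => x + s * f (k * t)) (s * (k * f' (k * t))).
Proof.
move=> df; apply/is_derive1_caratheodory.
have [g [gE gc g0]] := (is_derive1_caratheodory _ _ _).1 (df (k * t)).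
exists (fun u => s * (k * g (k * u))); split.
- move=> u; have := gE (k * u); rewrite -mulrBr => E.
  rewrite (_ : _ - _ = s * (f (k * u) - f (k * t))); last by ring.
  by rewrite E; ring.
- exact: continuous_rescale.
- by rewrite g0.
Qed.

Lemma circle_derive c s t :
  is_derive t (1 : R) (fun t => complex.Re (circle c s t))
    (s * (2 * pi * - sin (2 * pi * t))) /\
  is_derive t (1 : R) (fun t => complex.Im (circle c s t))
    (s * (2 * pi * cos (2 * pi * t))).
Proof.
split; rewrite /circle /=.
  by apply: (@is_derive_affine_comp _ (fun y => - sin y)) => y; exact: is_derive_cos.
by apply: is_derive_affine_comp => y; exact: is_derive_sin.
Qed.

Lemma circle_C1 c s : C1_arc (circle c s).
Proof.
have D t := circle_derive c s t.
split.
- by move=> t; case: (D t) => -[].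
- by move=> t; case: (D t) => _ [].
- rewrite (_ : derive1 _ = fun t => s * (2 * pi * - sin (2 * pi * t))); last first.
    by apply/funext => t; rewrite derive1E; case: (D t) => -[].
  move=> t; apply: (@continuous_rescale (fun y => - sin y)).
  by apply: continuousN; exact: continuous_sin.
- rewrite (_ : derive1 _ = fun t => s * (2 * pi * cos (2 * pi * t))); last first.
    by apply/funext => t; rewrite derive1E; case: (D t) => _ [].
  by move=> t; apply: continuous_rescale; exact: continuous_cos.
Qed.

Lemma velocity_circle c s t :
  velocity (circle c s) t = twopii * (circle c s t - c).
Proof.
rewrite /velocity !derive1E; case: (circle_derive c s t) => -[_ ->] [_ ->].
rewrite /circle /twopii; case: c => x y /=.
by congr (_ +i* _) => /=; ring.
Qed.

Lemma cabs_circle c s t : 0 <= s -> cabs (circle c s t - c) = s.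
Proof.
move=> s0; rewrite cabs_def /circle; case: c => x y /=.
rewrite [X in Num.sqrt X](_ : _ =
  s ^+ 2 * (cos (2 * pi * t) ^+ 2 + sin (2 * pi * t) ^+ 2)).
  by rewrite cos2Dsin2 mulr1 sqrtr_sqr ger0_norm.
by ring.
Qed.

Lemma circle_contour c s : contour [:: [:: circle c s]].
Proof.
move=> p; rewrite inE => /eqP ->; split; last first.
  by move=> g; rewrite inE => /eqP ->; exact: circle_C1.
rewrite /= andbT /circle mulr1 mulr0 cos0 sin0.
by rewrite mulr_natl cos2pi sin2pi.
Qed.

Lemma arc_integral_circle_center c s : 0 < s ->
  arc_integral (circle c s) (fun z => (z - c)^-1) = twopii.
Proof.
move=> s0; rewrite arc_integralE -[RHS]cint_cst; apply: eq_cint => t _.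
rewrite velocity_circle mulrCA mulVf ?mulr1// -cabs_gt0 cabs_circle//.
exact: ltW.
Qed.

(** On the disc of radius 2 s, which contains the circle but not a, the
    integrand has a primitive. *)
Lemma arc_integral_circle_out c s a : 0 < s -> 2 * s <= cabs (a - c) ->
  arc_integral (circle c s) (fun z => (z - a)^-1) = 0.
Proof.
move=> s0 sa; pose U := disc c (2 * s).
have s20 : 0 < 2 * s by rewrite mulr_gt0.
have za z : U z -> z - a != 0.
  move=> /discE zc; rewrite subr_eq0; apply: contraTneq zc => ->.
  by rewrite -leNgt.
have gs : smooth U (fun z => (z - a)^-1).
  move=> n; apply: (@diff_timesV _ n U (fun z => z - a)) => //.
  by apply: diff_timesD; [exact: diff_times_id|exact: diff_times_cst].
have [P dP] := smooth_primitive s20 gs.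
have gc := smooth_continuous gs.
have := contour_integral_exact (@circle_contour c s) _ dP gc.
rewrite /contour_integral /= big_seq1; apply.
move=> z [g]; rewrite /= inE => /eqP -> [t _ ->]; apply/discE.
by rewrite cabs_circle ?ltW// ltr_pMl// ltr1n.
Qed.

Lemma isolated_in_seq (r : seq C) c : exists2 d : R, 0 < d &
  forall b, b \in r -> b != c -> d <= cabs (b - c).
Proof.
elim: r => [|b r [d d0 IH]]; first by exists 1.
have [->|bc] := eqVneq b c.
  exists d => // b'; rewrite inE => /predU1P[->|]; first by rewrite eqxx.
  exact: IH.
exists (Num.min d (cabs (b - c))).
  by rewrite lt_min d0 cabs_gt0 subr_eq0.
move=> b'; rewrite inE ge_min => /predU1P[-> _|b'r b'c].
  by rewrite lexx orbT.
by rewrite IH.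
Qed.

(** One small circle around each eigenvalue, such that the concentric disc of
    twice the radius lies in U and contains no other eigenvalue. *)
Lemma enclosing_contour (U : set C) n (B : 'M[C]_n.+1) : open_set U ->
  spectrum B `<=` U -> exists G, encloses G (spectrum B) U.
Proof.
move=> oU BU.
have [r _ rB] := char_poly_split B.
have /choice[s Hs] (c : C) : exists s : R, c \in r -> [/\ 0 < s,
    forall w, cabs (w - c) < 2 * s -> U w &
    forall b, b \in r -> b != c -> 2 * s <= cabs (b - c)].
  have [cr|cr] := boolP (c \in r); last by exists 0.
  have /nbhsCP[d1 d10 h1] : \forall w \near c, U w by apply: oU; apply/BU/rB.
  have [d2 d20 h2] := isolated_in_seq r c.
  exists (Num.min d1 d2 / 2) => _; rewrite (mulrC 2) divfK ?pnatr_eq0//; split.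
  - by rewrite divr_gt0// lt_min d10.
  - by move=> w; rewrite lt_min => /andP[wd _]; exact: h1.
  - by move=> b br bc; rewrite ge_min h2// orbT.
pose G := [seq [:: circle c (s c)] | c <- undup r].
have flG : flatten G = [seq circle c (s c) | c <- undup r].
  exact: flatten_map1.
have wG a : winding G a = \sum_(c <- undup r)
    twopii^-1 * arc_integral (circle c (s c)) (fun z => (z - a)^-1).
  by rewrite /winding /contour_integral flG big_map mulr_sumr.
exists G; split.
- move=> p /mapP[c _ ->]; apply: (@circle_contour c (s c)); exact: mem_head.
- move=> z [g]; rewrite flG => /mapP[c]; rewrite mem_undup => cr -> [t _ ->].
  have [s0 sU sr] := Hs c cr.
  have cs : cabs (circle c (s c) t - c) = s c by rewrite cabs_circle ?ltW.
  have s2 : s c < 2 * s c by rewrite ltr_pMl// ltr1n.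
  split; first by apply: sU; rewrite cs.
  move=> /rB zr; have := sr _ zr; rewrite cs leNgt s2 => /(_ _)/negP.
  by rewrite -subr_eq0 -cabs_eq0 cs gt_eqF//; apply.
- move=> a /rB ar; rewrite wG (bigD1_seq a) ?undup_uniq ?mem_undup//=.
  have [s0 _ _] := Hs a ar.
  rewrite arc_integral_circle_center// mulVf ?twopii_neq0// big_seq_cond big1 ?addr0//.
  move=> c /andP[]; rewrite mem_undup => cr ca; have [sc0 _ sr] := Hs c cr.
  by rewrite arc_integral_circle_out ?mulr0// sr// eq_sym.
- move=> a aU; rewrite wG big_seq big1// => c; rewrite mem_undup => cr.
  have [s0 sU _] := Hs c cr.
  rewrite arc_integral_circle_out ?mulr0// leNgt; apply/negP => h.
  by apply: aU; exact: sU.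
Qed.

End Circles.

(** * Functional calculus on a disc *)

Section DiscCalculus.
Context {R : realType} {n : nat}.
Local Notation C := R[i].
Variables (z0 : C) (rho : R).
Hypothesis rho0 : 0 < rho.
Local Notation U := (disc z0 rho).
Implicit Types (g h : C -> C) (p : {poly C}) (A B : 'M[C]_n.+1).

Lemma contour_integral_smooth0 G h : contour G -> support_of G `<=` U ->
  smooth U h -> contour_integral G h = 0.
Proof.
move=> cG GU hs; have [P dP] := smooth_primitive rho0 hs.
exact: contour_integral_exact cG GU dP (smooth_continuous hs).
Qed.

(** Newton interpolation: successive divisions by z - a for a in s. *)
Lemma smooth_interpolation g (s : seq C) : smooth U g ->
  (forall a, a \in s -> U a) ->
  exists p h, smooth U h /\
    forall z, U z -> g z = p.[z] + (prod_XsubC s).[z] * h z.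
Proof.
elim: s g => [|a s IH] g gs sU.
  exists 0, g; split=> // z _.
  by rewrite /prod_XsubC big_nil !hornerE.
have Ua : U a by apply: sU; exact: mem_head.
have [g1 g1s g1E] := smooth_divide Ua gs.
have [|p [h [hs hE]]] := IH g1 g1s; first by move=> b bs; apply: sU; rewrite inE bs orbT.
exists ((g a)%:P + ('X - a%:P) * p), h; split=> // z Uz.
rewrite g1E// hE// prod_XsubC_cons hornerD hornerC hornerM hornerXsubC.
by ring.
Qed.

Lemma char_poly_interpolation B g : spectrum B `<=` U -> smooth U g ->
  exists p h, smooth U h /\
    forall z, U z -> g z = p.[z] + (char_poly B).[z] * h z.
Proof.
move=> BU gs; have [r -> rB] := char_poly_split B.
by apply: smooth_interpolation => // a /rB; exact: BU.
Qed.

Lemma resolvent_integral_smooth B G g h p : encloses G (spectrum B) U ->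
  smooth U h -> (forall z, U z -> g z = p.[z] + (char_poly B).[z] * h z) ->
  resolvent_integral G g B = horner_mx B p.
Proof.
move=> eG hs gE; apply: (resolvent_integral_poly eG gE).
  exact: smooth_continuous.
case: eG => cG GU _ _ q; apply: contour_integral_smooth0 => //.
  by move=> z /GU[].
by move=> k; apply: diff_timesM => //; exact: diff_times_horner.
Qed.

Lemma matfun_smooth B g h p : spectrum B `<=` U ->
  smooth U h -> (forall z, U z -> g z = p.[z] + (char_poly B).[z] * h z) ->
  matfun U g B = horner_mx B p.
Proof.
move=> BU hs gE; apply: matfun_eq.
  by apply: enclosing_contour => //; exact: open_disc.
by move=> G eG; exact: resolvent_integral_smooth eG hs gE.
Qed.

Lemma horner_mx_comp B p q :
  horner_mx B (p \Po q) = horner_mx (horner_mx B q) p.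
Proof.
elim/poly_ind: p => [|p c IH]; first by rewrite comp_poly0 !rmorph0.
rewrite comp_polyD comp_polyM comp_polyX comp_polyC !rmorphD !rmorphM /=.
by rewrite IH horner_mx_X !horner_mx_C.
Qed.

(** The homothety of centre z0 and ratio x; g((1 - x) z0 + x A) is the value
    at A of the composite of g with it. *)
Definition shrink (x z : C) : C := z0 + x * (z - z0).

Definition shrink_mx A (t : R) : 'M[C]_n.+1 := (1 - t%:C) *: z0%:M + t%:C *: A.

Lemma shrink_disc (t : R) z : 0 <= t <= 1 -> U z -> U (shrink t%:C z).
Proof.
move=> t01 /discE zr; apply/discE.
by apply: segment_disc => //; rewrite subrr cabs0.
Qed.

Lemma smooth_shrink g (t : R) : 0 <= t <= 1 -> smooth U g ->
  smooth U (fun z => g (shrink t%:C z)).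
Proof.
move=> t01 gs k.
rewrite (_ : (fun z => _) = fun z => g (z0 - t%:C * z0 + t%:C * z)); last first.
  by apply/funext => z; congr g; rewrite /shrink; ring.
apply: (@diff_times_affine _ k U) => // z Uz.
have := shrink_disc t01 Uz; rewrite /shrink.
by rewrite (_ : _ + _ = z0 - t%:C * z0 + t%:C * z)//; ring.
Qed.

Lemma char_poly_shrink A (t : R) z :
  (char_poly (shrink_mx A t)).[shrink t%:C z] = t%:C ^+ n.+1 * (char_poly A).[z].
Proof.
rewrite !char_poly_horner -detZ; congr (\det _); apply/matrixP => i j.
rewrite !mxE /shrink; case: (i == j); rewrite ?mulr1n ?mulr0n; ring.
Qed.

Lemma spectrum_shrink A (t : R) : 0 <= t <= 1 -> spectrum A `<=` U ->
  spectrum (shrink_mx A t) `<=` U.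
Proof.
move=> t01 AU mu /eigenvalueP[w wB w0].
have [t0|tN0] := eqVneq t 0.
  have : mu *: w = z0 *: w.
    by rewrite -wB /shrink_mx t0 rmorph0 scale0r addr0 subr0 scale1r mul_mx_scalar.
  move=> /eqP; rewrite -subr_eq0 -scalerBl scaler_eq0 (negPf w0) orbF subr_eq0.
  by move=> /eqP ->; apply/discE; rewrite subrr cabs0.
have tC0 : t%:C != 0 :> C by rewrite -cabs_eq0 cabsR normr_eq0.
pose l := (mu - (1 - t%:C) * z0) / t%:C.
have -> : mu = shrink t%:C l by rewrite /shrink /l; field.
apply: shrink_disc => //; apply: AU; apply/eigenvalueP; exists w => //.
apply: (scalerI tC0); rewrite scalerA /l mulrC divfK// scalerBl -wB.
by rewrite /shrink_mx mulmxDr -!scalemxAr mul_mx_scalar scalerA addrC addKr.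
Qed.

Variables (A : 'M[C]_n.+1) (G : seq (seq (R -> C))).
Hypothesis AU : spectrum A `<=` U.
Hypothesis eG : encloses G (spectrum A) U.

(** The parameter x is moved from the matrix to the function, so that the
    contour, which surrounds the spectrum of A, does not depend on x. *)
Definition shrunk_calculus g (x : C) : 'M[C]_n.+1 :=
  resolvent_integral G (fun z => g (shrink x z)) A.

(** At z0 + t (z - z0), the characteristic polynomial of (1 - t) z0 + t A is
    t^n.+1 times that of A at z; thus an interpolation of g for the former
    matrix pulls back to one of the shrunk function for A. *)
Lemma shrunk_calculusE g (t : R) : 0 <= t <= 1 -> smooth U g ->
  matfun U g (shrink_mx A t) = shrunk_calculus g t%:C.
Proof.
move=> t01 gs; have BU := spectrum_shrink t01 AU.
have [p [h [hs gE]]] := char_poly_interpolation BU gs.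
rewrite (matfun_smooth BU hs gE).
pose q : {poly C} := (z0 - t%:C * z0)%:P + t%:C *: 'X.
have qE z : q.[z] = shrink t%:C z.
  by rewrite /q hornerD hornerC hornerZ hornerX /shrink; ring.
rewrite /shrunk_calculus (@resolvent_integral_smooth _ _ _
  (fun z => t%:C ^+ n.+1 * h (shrink t%:C z)) (p \Po q) eG).
- rewrite horner_mx_comp; congr (horner_mx _ p).
  rewrite /q rmorphD /= horner_mx_C horner_mxZ horner_mx_X /shrink_mx.
  by congr (_ + _); rewrite scale_scalar_mx mulrBl mul1r.
- move=> k; apply: diff_timesM; first exact: diff_times_cst.
  exact: smooth_shrink.
- move=> z Uz; rewrite gE; last exact: shrink_disc.
  by rewrite char_poly_shrink horner_comp qE; ring.
Qed.

Lemma shrunk_calculus_mul g (t : R) : 0 <= t <= 1 -> smooth U g ->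
  resolvent_integral G (fun z => g (shrink t%:C z) * (z - z0)) A =
  (A - z0%:M) *m shrunk_calculus g t%:C.
Proof.
move=> t01 gs.
have [p [h [hs gE]]] := char_poly_interpolation AU (smooth_shrink t01 gs).
rewrite /shrunk_calculus (resolvent_integral_smooth eG hs gE).
rewrite (@resolvent_integral_smooth _ _ _ (fun z => h z * (z - z0))
  (('X - z0%:P) * p) eG).
- by rewrite rmorphM rmorphB /= horner_mx_X horner_mx_C.
- move=> k; apply: diff_timesM => //; apply: diff_timesD; first exact: diff_times_id.
  exact: diff_times_cst.
- by move=> z Uz; rewrite gE// hornerM hornerXsubC; ring.
Qed.

Lemma shrunk_calculus_deriv g (t : R) i j : 0 <= t <= 1 -> smooth U g ->
  cderiv (fun x => shrunk_calculus g x i j) t%:C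
    (((A - z0%:M) *m shrunk_calculus (derive1 g) t%:C) i j).
Proof.
move=> t01 gs; have [dg g's] := smooth_derive1 (@open_disc _ z0 rho) gs.
rewrite -shrunk_calculus_mul// /shrunk_calculus /resolvent_integral.
case: (eG) => cG GU _ _.
have H (c : R -> C) : c \in flatten G ->
    cderiv (fun x => cint (fun s => g (z0 + x * (c s - z0)) *
        (invmx ((c s)%:M - A) i j * velocity c s))) t%:C
      (cint (fun s => derive1 g (z0 + t%:C * (c s - z0)) * (c s - z0) *
        (invmx ((c s)%:M - A) i j * velocity c s))).
  move=> cF; have [ca cs] := arc_of_contour cG cF.
  have c01 := C1_arc_cont01 ca.
  apply: (cint_parametric_derivative (@open_disc _ z0 rho) dg
    (smooth_continuous g's)).
  - exact: cont01_cst.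
  - by apply: cont01D => //; exact: cont01_cst.
  - apply: cont01M; last exact: velocity_cont01.
    apply: (cont01_comp (g := fun z => invmx (z%:M - A) i j)) => // s /cs cGs.
    by apply: (@resolvent_continuous _ _ A (support_of G)) => // z /GU[].
  - by move=> s /cs /GU[Uc _]; exact: shrink_disc.
apply: slope_ext (slope_eq _ (slopeZ (@tends_id R t%:C) twopii^-1 (slope_sum H))).
  move=> x; rewrite !mxE; congr (_ * _); apply: eq_bigr => c _.
  by rewrite arc_integralE; apply: eq_cint => s _; rewrite mulrA.
rewrite !mxE; congr (_ * _); apply: eq_bigr => c _.
by rewrite arc_integralE; apply: eq_cint => s _; rewrite mulrA.
Qed.

End DiscCalculus.

(** * Higher derivatives *)

Section HigherDerivatives.
Context {R : realType}.
Local Notation C := R[i].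
Implicit Types (V : set C) (g h e : C -> C).

Lemma derive1_eq_on V g h : open_set V -> smooth V g ->
  (forall z, V z -> g z = h z) -> forall z, V z -> derive1 g z = derive1 h z.
Proof.
move=> oV gs gh z Vz; have [dg _] := smooth_derive1 oV gs.
by rewrite (cderiv_derive1 (deriv_on_eq oV gh dg Vz)).
Qed.

Lemma derive1n_eq_on V k g h : open_set V -> smooth V g ->
  (forall z, V z -> g z = h z) -> forall z, V z -> derive1n k g z = derive1n k h z.
Proof.
move=> oV gs gh; elim: k => [|k IH] z Vz; first exact: gh.
rewrite !derive1nS; apply: (derive1_eq_on oV _ IH Vz).
exact: smooth_derive1n.
Qed.

Lemma smoothD V g h : smooth V g -> smooth V h -> smooth V (fun z => g z + h z).
Proof. by move=> gs hs n; exact: diff_timesD. Qed.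

Lemma smoothM V g h : smooth V g -> smooth V h -> smooth V (fun z => g z * h z).
Proof. by move=> gs hs n; exact: diff_timesM. Qed.

Lemma smoothB V g h : smooth V g -> smooth V h -> smooth V (fun z => g z - h z).
Proof.
move=> gs hs; rewrite (_ : (fun z => _) = fun z => g z + -1 * h z); last first.
  by apply/funext => z; rewrite mulN1r.
by apply: smoothD => //; apply: smoothM => // n; exact: diff_times_cst.
Qed.

Lemma derive1nD V k g h : open_set V -> smooth V g -> smooth V h ->
  forall z, V z -> derive1n k (fun z => g z + h z) z = derive1n k g z + derive1n k h z.
Proof.
move=> oV gs hs; elim: k => [|k IH] z Vz; first by [].
rewrite !derive1nS.
have [dg _] := smooth_derive1 oV (smooth_derive1n k oV gs).
have [dh _] := smooth_derive1 oV (smooth_derive1n k oV hs).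
rewrite (derive1_eq_on oV _ IH Vz); last first.
  by apply: smooth_derive1n => //; exact: smoothD.
exact: cderiv_derive1 (slopeD (dg z Vz) (dh z Vz)).
Qed.

Lemma derive1nB V k g h : open_set V -> smooth V g -> smooth V h ->
  forall z, V z -> derive1n k (fun z => g z - h z) z = derive1n k g z - derive1n k h z.
Proof.
move=> oV gs hs; elim: k => [|k IH] z Vz; first by [].
rewrite !derive1nS.
have [dg _] := smooth_derive1 oV (smooth_derive1n k oV gs).
have [dh _] := smooth_derive1 oV (smooth_derive1n k oV hs).
rewrite (derive1_eq_on oV _ IH Vz); last first.
  by apply: smooth_derive1n => //; exact: smoothB.
exact: cderiv_derive1 (slopeB (dg z Vz) (dh z Vz)).
Qed.

Lemma derive1n_horner k (p : {poly C}) : derive1n k (horner p) = horner (p^`(k)).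
Proof.
elim: k => [|k IH]; first by [].
rewrite derive1nS IH derivnS; move: (p^`(k)) => q {p IH}.
apply/funext => z; apply: cderiv_derive1.
elim/poly_ind: q => [|q c IH].
  rewrite deriv0 horner0.
  by apply: slope_ext (slope_cst _ _ 0) => w; rewrite horner0.
have H := slopeD (slopeM (@tends_id R z) IH (slope_id _ z)) (slope_cst _ z c).
rewrite derivMXaddC hornerD hornerMX.
apply: slope_ext (slope_eq _ H) => [w|]; first by rewrite hornerMXaddC.
by rewrite mulr1 addr0 addrC.
Qed.

(** Induction on N from (g e)' = g' e + g e'. *)
Lemma vanishing_order_mul V z0 N g e : open_set V -> V z0 ->
  smooth V g -> smooth V e ->
  (forall j, (j < N)%N -> derive1n j e z0 = 0) ->
  forall j, (j < N)%N -> derive1n j (fun z => g z * e z) z0 = 0.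
Proof.
move=> oV Vz0; elim: N g e => // N IH g e gs es e0 [|j] jN.
  by rewrite /=; have /= -> := e0 0%N isT; rewrite mulr0.
rewrite derive1Sn.
have [dg g's] := smooth_derive1 oV gs; have [de e's] := smooth_derive1 oV es.
have E z : V z -> derive1 g z * e z + g z * derive1 e z =
    derive1 (fun z => g z * e z) z.
  move=> Vz; symmetry; apply: cderiv_derive1.
  exact: (slopeM (@tends_id R z) (dg z Vz) (de z Vz)).
have s1 := smoothM g's es; have s2 := smoothM gs e's.
rewrite -(derive1n_eq_on j oV (smoothD s1 s2) E Vz0) (derive1nD j oV s1 s2 Vz0).
rewrite (IH _ _ g's es) ?(IH _ _ gs e's) ?addr0// => k kN.
  by rewrite -derive1Sn; exact: e0.
by apply: e0; exact: ltnW.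
Qed.

End HigherDerivatives.

(** * Norms on matrices *)

Section MatrixNorm.
Context {R : realType} {n : nat}.
Local Notation C := R[i].
Local Notation M := 'M[C]_n.
Variable nrm : M -> R.
Hypothesis hnrm : is_norm nrm.
Implicit Types (X Y : M).

Lemma nrmZ c X : nrm (c *: X) = cabs c * nrm X.
Proof.
have := nrm_scale hnrm c X; rewrite cabsE -rmorphM => /(congr1 (@complex.Re R)).
by [].
Qed.

Lemma nrmD X Y : nrm (X + Y) <= nrm X + nrm Y.
Proof. exact: nrm_triangle. Qed.

Lemma nrm0 : nrm 0 = 0.
Proof. by rewrite -(scale0r (0 : M)) nrmZ cabs0 mul0r. Qed.

Lemma nrmN X : nrm (- X) = nrm X.
Proof. by rewrite -scaleN1r nrmZ cabsN cabs1 mul1r. Qed.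

Lemma nrm_ge0 X : 0 <= nrm X.
Proof.
have := nrmD X (- X); rewrite subrr nrm0 nrmN => h.
by rewrite -(pmulr_rge0 _ (ltr0n R 2)) mulr_natl mulr2n.
Qed.

Lemma nrm_sum (I : Type) (r : seq I) (F : I -> M) :
  nrm (\sum_(i <- r) F i) <= \sum_(i <- r) nrm (F i).
Proof.
elim: r => [|i r IH]; first by rewrite !big_nil nrm0.
by rewrite !big_cons; apply: le_trans (nrmD _ _) _; rewrite lerD2l.
Qed.

(** Expanding X on the matrix units; this turns entrywise limits into limits
    for an arbitrary norm. *)
Lemma nrm_entries : exists2 K : R, 0 < K & forall X (e : R), 0 <= e ->
  (forall i j, cabs (X i j) <= e) -> nrm X <= K * e.
Proof.
pose S := \sum_(i < n) \sum_(j < n) nrm (delta_mx i j).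
have S0 : 0 <= S by do 2 (apply: sumr_ge0 => ? _); exact: nrm_ge0.
exists (S + 1); first by rewrite ltr_pwDr.
move=> X e e0 Xe; apply: (@le_trans _ _ (S * e)); last first.
  by apply: ler_wpM2r => //; rewrite lerDl.
rewrite {1}(matrix_sum_delta X); apply: le_trans (nrm_sum _ _) _.
rewrite /S mulr_suml; apply: ler_sum => i _.
apply: le_trans (nrm_sum _ _) _; rewrite mulr_suml; apply: ler_sum => j _.
by rewrite nrmZ mulrC; apply: ler_wpM2l; [exact: nrm_ge0|exact: Xe].
Qed.

Lemma nrm_near (T : Type) (F : set_system T) (X : T -> M) (b : T -> R) :
  Filter F -> (forall x, 0 <= b x) ->
  (forall i j (e : R), 0 < e -> \forall x \near F, cabs (X x i j) <= e * b x) ->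
  forall e : R, 0 < e -> \forall x \near F, nrm (X x) <= e * b x.
Proof.
move=> FF b0 H e e0; have [K K0 KX] := nrm_entries.
have eK : 0 < e / K by rewrite divr_gt0.
have H2 : \forall x \near F, forall i, forall j, cabs (X x i j) <= e / K * b x.
  apply: filter_forall => i; apply: filter_forall => j; exact: H.
apply: filterS H2 => x Hx.
apply: le_trans (KX _ (e / K * b x) _ Hx) _; first by rewrite mulr_ge0// ltW.
by rewrite mulrA mulrCA mulfV ?mulr1// lt0r_neq0.
Qed.

Lemma nrm_continuous (X : R -> M) (t : R) :
  (forall i j, tends (nbhs t) (fun s => X s i j) (X t i j)) ->
  nrm (X s) @[s --> t] --> nrm (X t).
Proof.
move=> Xc; apply/(@cvgrPdist_lt R R^o) => e e0.
have e20 : 0 < e / 2 by rewrite divr_gt0.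
have HH i j (d : R) : 0 < d -> \forall s \near t, cabs ((X s - X t) i j) <= d * 1.
  by move=> d0; apply: filterS (Xc i j d d0) => s; rewrite !mxE mulr1 => /ltW.
have H := nrm_near (nbhs_filter t) (fun=> ler01) HH e20.
apply: filterS H => s; rewrite mulr1 => Xs.
apply: le_lt_trans (_ : e / 2 < e); last by rewrite ltr_pdivrMr// ltr_pMr// ltr1n.
apply: le_trans Xs; rewrite ler_norml; apply/andP; split.
  have := nrmD (X t) (X s - X t); rewrite [X t + _]addrC subrK; lra.
have := nrmD (X s) (X t - X s); rewrite [X s + _]addrC subrK -[X t - X s]opprB nrmN; lra.
Qed.

Lemma nrm_max01 (X : R -> M) :
  (forall t : R, 0 <= t <= 1 -> forall i j,
     tends (nbhs t) (fun s => X s i j) (X t i j)) ->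
  exists2 t0 : R, 0 <= t0 <= 1 & forall t, 0 <= t <= 1 -> nrm (X t) <= nrm (X t0).
Proof.
move=> Xc; have wc : {within `[0, 1], continuous (fun t => nrm (X t))}.
  apply: continuous_in_subspaceT => t.
  by rewrite inE /= in_itv /= => t01; apply: nrm_continuous; exact: Xc.
have [t0] := EVT_max ler01 wc; rewrite in_itv /= => t001 t0max.
by exists t0 => [//|t t01]; apply: t0max; rewrite in_itv.
Qed.

(** The weights m.+1 (1 - t)^m are the derivative of - (1 - t)^m.+1, whose
    total increment is 1. *)
Lemma nrm_mean_value (Y : C -> M) (Q : R -> M) (m : nat) (K : R) :
  (forall t : R, 0 <= t <= 1 -> forall i k,
     cderiv (fun x => Y x i k) t%:C (((m.+1%:R * (1 - t%:C) ^+ m) *: Q t) i k)) ->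
  (forall t, 0 <= t <= 1 -> nrm (Q t) <= K) ->
  nrm (Y 1 - Y 0) <= K.
Proof.
move=> dY QK.
have E1 (t : R) : 1 - t%:C = (1 - t)%:C :> C by rewrite rmorphB rmorph1.
have := @mean_value_ineq R _ nrm (fun t => Y t%:C)
  (fun t => (m.+1%:R * (1 - t%:C) ^+ m) *: Q t)
  (fun t => - K * (1 - t) ^+ m.+1) (fun t => m.+1%:R * (1 - t) ^+ m * K).
rewrite rmorph1 rmorph0 subrr subr0 expr1n mulr1 expr0n /= mulr0 sub0r opprK.
apply.
- exact: nrmD.
- exact: nrmZ.
- move=> t t01 e e0.
  apply: (nrm_near (nbhs_filter t) (fun s => normr_ge0 (s - t))) e0 => i k d d0.
  have idR : rderiv (fun s : R => s%:C) t 1 by exact: slope_id.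
  have := slope_eps (rderiv_comp idR (dY t t01 i k)) d0.
  apply: filterS => s.
  have -> : s%:C - t%:C = (s - t)%:C :> C by rewrite rmorphB.
  by rewrite mulr1 cabsR !mxE [_ * (s - t)%:C]mulrC.
- move=> t _; have idt := tends_real_complex t.
  have d1 : rderiv (fun s : R => 1 - s%:C) t (-1).
    by apply: slope_eq (slopeB (slope_cst _ t 1) (slope_id _ t)); rewrite sub0r.
  have := slopeZ idt (- K)%:C (slopeX idt m.+1 d1); rewrite /= => D.
  have [+ _] := (rderivP _ _ _).1 D.
  rewrite (_ : (fun x => _) = fun x : R => - K * (1 - x) ^+ m.+1); last first.
    apply/funext => x.
    by rewrite E1 -rmorphXn -rmorphM.
  rewrite (_ : complex.Re _ = m.+1%:R * (1 - t) ^+ m * K)//.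
  rewrite E1 -rmorphXn.
  rewrite -(rmorph_nat (real_complex R)) -!rmorphN -!rmorphM /=.
  by ring.
- move=> t t01; rewrite nrmZ E1 cabsM cabsX cabsn cabsR.
  rewrite ger0_norm; last by case/andP: t01; rewrite subr_ge0.
  apply: ler_wpM2l; last exact: QK.
  by case/andP: t01 => _ t1; rewrite mulr_ge0// exprn_ge0// subr_ge0.
Qed.

End MatrixNorm.

(** * Taylor's formula along a segment of matrices *)

Section Taylor.
Context {R : realType}.
Local Notation C := R[i].

(** The derivative of each coefficient cancels the term produced by
    differentiating the preceding factor M. *)
Lemma taylor_telescope (m : nat) (M : nat -> C -> C) (t : C) :
  (forall j, (j <= m)%N -> cderiv (M j) t (M j.+1 t)) ->
  cderiv (fun x => \sum_(j < m.+1) (1 - x) ^+ j / j`!%:R * M j x) t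
    ((1 - t) ^+ m / m`!%:R * M m.+1 t).
Proof.
have it := @tends_id R t.
have d1 : cderiv (fun x => 1 - x) t (-1).
  by apply: slope_eq (slopeB (slope_cst _ t 1) (slope_id _ t)); rewrite sub0r.
elim: m => [|m IH] dM.
  apply: slope_ext (slope_eq _ (dM 0%N isT)) => [x|].
    by rewrite big_ord1 expr0 fact0 divr1 mul1r.
  by rewrite expr0 fact0 divr1 mul1r.
have IH' := IH (fun j jm => dM j (leqW jm)).
have f0 : (m`!%:R : C) != 0 by rewrite pnatr_eq0 -lt0n fact_gt0.
have m0 : (m.+1%:R : C) != 0 by rewrite pnatr_eq0.
have dc := slopeM it (slopeX it m.+1 d1) (slope_cst _ t (m.+1`!%:R)^-1).
apply: slope_ext (slope_eq _ (slopeD IH' (slopeM it dc (dM m.+1 (leqnn _))))) => [x|].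
  by rewrite [RHS]big_ord_recr.
rewrite /= factS natrM; move: f0 m0.
move: (m.+1%:R : C) (m`!%:R : C) => c d d0 c0.
by field; rewrite d0 c0.
Qed.

End Taylor.

Section MatrixTaylor.
Context {R : realType} {n : nat}.
Local Notation C := R[i].
Variables (z0 : C) (rho : R) (A : 'M[C]_n.+1) (G : seq (seq (R -> C))).
Hypothesis rho0 : 0 < rho.
Hypothesis AU : spectrum A `<=` disc z0 rho.
Hypothesis eG : encloses G (spectrum A) (disc z0 rho).
Implicit Types (g : C -> C) (m : nat).

Lemma mulmx_deriv (W D : 'M[C]_n.+1) (Y : C -> 'M[C]_n.+1) (x : C) :
  (forall i k, cderiv (fun y => Y y i k) x (D i k)) ->
  forall i k, cderiv (fun y => (W *m Y y) i k) x ((W *m D) i k).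
Proof.
move=> dY i k; have S := slope_sum (fun l (_ : l \in index_enum 'I_n.+1) =>
  slopeZ (@tends_id R x) (W i l) (dY l k)).
by apply: slope_ext (slope_eq _ S) => [y|]; rewrite mxE.
Qed.

Definition taylor_mx g m (x : C) : 'M[C]_n.+1 :=
  \sum_(j < m) ((1 - x) ^+ j / j`!%:R) *:
    ((A - z0%:M) ^+ j *m shrunk_calculus z0 A G (derive1n j g) x).

Lemma taylor_mx_deriv g m (t : R) : 0 <= t <= 1 -> smooth (disc z0 rho) g ->
  forall i k, cderiv (fun x => taylor_mx g m.+1 x i k) t%:C
    ((((1 - t%:C) ^+ m / m`!%:R) *: ((A - z0%:M) ^+ m.+1 *m
       shrunk_calculus z0 A G (derive1n m.+1 g) t%:C)) i k).
Proof.
move=> t01 gs i k; set X := A - z0%:M.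
have dM j : cderiv (fun x => (X ^+ j *m shrunk_calculus z0 A G (derive1n j g) x) i k) t%:C
    ((X ^+ j.+1 *m shrunk_calculus z0 A G (derive1n j.+1 g) t%:C) i k).
  have gjs := smooth_derive1n j (@open_disc _ z0 rho) gs.
  have := mulmx_deriv (X ^+ j)
    (fun i k => shrunk_calculus_deriv rho0 AU eG i k t01 gjs).
  by move=> /(_ i k); rewrite mulmxA exprSr -derive1nS; exact.
have TT := @taylor_telescope R m (fun j x =>
  (X ^+ j *m shrunk_calculus z0 A G (derive1n j g) x) i k) t%:C (fun j _ => dM j).
apply: slope_ext (slope_eq _ TT) => [x|]; last by rewrite [RHS]mxE.
by rewrite /taylor_mx summxE; apply: eq_bigr => j _; rewrite [RHS]mxE.
Qed.

Lemma taylor_mx0 g m :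
  (forall j, (j < m)%N -> derive1n j g z0 = 0) -> taylor_mx g m 0 = 0.
Proof.
move=> g0; apply: big1 => j _.
have -> : shrunk_calculus z0 A G (derive1n j g) 0 = 0.
  rewrite /shrunk_calculus /resolvent_integral.
  apply/matrixP => i k; rewrite !mxE.
  rewrite (@eq_contour_integral _ _ _ (fun=> 0)) ?contour_integral0 ?mulr0//.
  by move=> z _; rewrite /shrink mul0r addr0 g0// mul0r.
by rewrite mulmx0 scaler0.
Qed.

Lemma taylor_mx1 g m : taylor_mx g m.+1 1 = shrunk_calculus z0 A G g 1.
Proof.
rewrite /taylor_mx big_ord_recl big1 ?addr0; last first.
  by move=> j _; rewrite subrr expr0n mul0r scale0r.
by rewrite expr0 fact0 divr1 scale1r mul1mx.
Qed.

End MatrixTaylor.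

(** * Matrix functions in the estimate *)

Section PadeError.
Context {R : realType} {n : nat}.
Local Notation C := R[i].
Implicit Types (p q u v : {poly C}).

Lemma matfun_poly (A : 'M[C]_n.+1) p : matfun setT (horner p) A = horner_mx A p.
Proof.
have oT : open_set (setT : set C) by move=> z _; exact: filterT.
apply: matfun_eq; first by apply: enclosing_contour => // z _.
move=> G eG; apply: (resolvent_integral_poly (h := fun=> 0) eG).
- by move=> z _; rewrite mulr0 addr0.
- by move=> z _; exact: tends_cst.
- move=> q; rewrite -[RHS](contour_integral0 G).
  by apply: eq_contour_integral => z _; rewrite mul0r.
Qed.

Lemma spectrum_coprime_inverse (A : 'M[C]_n.+1) v :
  (forall z, spectrum A z -> v.[z] != 0) ->
  exists p q, p * v + q * char_poly A = 1.
Proof.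
move=> hv; have : coprimep (char_poly A) v.
  apply: Pdiv.ClosedField.root_coprimep => z.
  by rewrite -eigenvalue_root_char; exact: hv.
rewrite coprimep_sym => /Bezout_eq1_coprimepP[[p q] /= E].
by exists p, q.
Qed.

(** By the Bezout identity u / v = u p + chi (u q / v), where chi is the
    characteristic polynomial of A and u q / v has its poles among the roots
    of v, around which the contour does not turn. *)
Lemma matfun_rational (A : 'M[C]_n.+1) u v p q : v != 0 ->
  (forall z, spectrum A z -> v.[z] != 0) ->
  p * v + q * char_poly A = 1 ->
  matfun [set z | v.[z] != 0] (fun z => u.[z] / v.[z]) A = horner_mx A (u * p).
Proof.
move=> v0 hv E; apply: matfun_eq.
  by apply: enclosing_contour => //; exact: open_nonroot.
move=> G eG; apply: (resolvent_integral_poly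
  (h := fun z => (u * q).[z] / v.[z]) eG).
- move=> z /= vz; rewrite !hornerM.
  have : p.[z] * v.[z] + q.[z] * (char_poly A).[z] = 1.
    by rewrite -!hornerM -hornerD E hornerC.
  move: (char_poly A).[z] => c Ez.
  rewrite -[u.[z] in LHS]mulr1 -Ez; field; exact: vz.
- by apply: rational_continuous.
- move=> s; case: eG => cG GU _ w0.
  rewrite (@eq_contour_integral _ _ _ (fun z => (u * q * s).[z] / v.[z])).
    apply: contour_integral_rational0 => // a /rootP va.
      by move=> /GU[/=]; rewrite va eqxx.
    by apply: w0 => /=; rewrite va eqxx.
  by move=> z _; rewrite [(u * q * s).[z]]hornerM mulrAC.
Qed.

(** Near z0, v f - u is the product of v with f - u / v, which vanishes to
    order L + M + 1. *)
Lemma pade_error_vanishes (f : C -> C) (z0 : C) (rho : R) (L M : nat) u v :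
  0 < rho -> smooth (disc z0 rho) f -> is_pade L M f z0 u v ->
  forall j, (j < L + M + 1)%N ->
    derive1n j (fun z => v.[z] * f z - u.[z]) z0 = 0.
Proof.
move=> rho0 fs [_ _ v0 interp] j jN.
pose V := [set z | disc z0 rho z /\ v.[z] != 0].
have oV : open_set V.
  by move=> z [Uz vz]; apply: filterI; [exact: open_disc Uz|exact: open_nonroot vz].
have Vz0 : V z0 by split => //; apply/discE; rewrite subrr cabs0.
have fV : smooth V f by move=> k; apply: diff_times_sub (fs k) => z [].
have rV : smooth V (fun z => u.[z] / v.[z]).
  by move=> k; apply: diff_times_sub (smooth_rational u v k) => z [].
have eV := smoothB fV rV; have vV := smooth_poly V v.
rewrite -(derive1n_eq_on j oV (smoothM vV eV) _ Vz0).
  apply: (vanishing_order_mul oV Vz0 vV eV) jN => k kN.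
  by rewrite (derive1nB k oV fV rV Vz0) interp// subrr.
by move=> z [_ vz]; field.
Qed.

End PadeError.

(** * The error estimate *)

Theorem corollary15 (R : realType) (n : nat) (f : R[i] -> R[i]) (z0 : R[i])
    (rho : R) (A : 'M[R[i]]_n.+1) (L M : nat) (u v : {poly R[i]})
    (nrm : 'M[R[i]]_n.+1 -> R)
    (hrho : 0 < rho)
    (hf : analytic_on (disc z0 rho) f)
    (hA : spectrum A `<=` disc z0 rho)
    (huv : is_pade L M f z0 u v)
    (hv : forall z, spectrum A z -> v.[z] != 0)
    (hnrm : is_norm nrm) :
  let N := (L + M + 1)%N in
  let r := fun z => u.[z] / v.[z] in
  let fA := matfun (disc z0 rho) f A in
  let rA := matfun [set z | v.[z] != 0] r A in
  let vA := matfun setT (fun z => v.[z]) A in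
  let phi := fun t : R =>
    nrm ((A - z0%:M) ^+ N *m invmx vA *m
         ((N`!%:R)^-1 *:
            matfun (disc z0 rho) (derive1n N (fun z => v.[z] * f z))
              ((1 - t%:C) *: z0%:M + t%:C *: A))) in
  exists2 t0 : R, 0 <= t0 <= 1 &
    (forall t : R, 0 <= t <= 1 -> phi t <= phi t0) /\
    nrm (fA - rA) <= phi t0.
Proof.
move=> N r fA rA vA phi.
have oU : open_set (disc z0 rho) by exact: open_disc.
have fs := analytic_smooth oU hf.
have vs := smooth_poly (disc z0 rho) v.
have us := smooth_poly (disc z0 rho) u.
pose F z := v.[z] * f z; have Fs : smooth (disc z0 rho) F by exact: smoothM.
pose H z := F z - u.[z]; have Hs : smooth (disc z0 rho) H by exact: smoothB.
have v0 : v != 0.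
  by apply: contraNneq (pade_den_neq0 huv) => ->; rewrite horner0.
have H0 j : (j < N)%N -> derive1n j H z0 = 0.
  exact: (pade_error_vanishes hrho fs huv).
(* The N-th derivative of u vanishes because N exceeds its degree. *)
have HN z : disc z0 rho z -> derive1n N H z = derive1n N F z.
  move=> Uz; rewrite (derive1nB N oU Fs us Uz) derive1n_horner.
  rewrite derivn_poly0 ?horner0 ?subr0//.
  by apply: leq_trans (pade_num huv) _; rewrite /N addn1 ltnS leq_addr.
have [G eG] := enclosing_contour oU hA.
have GU z : support_of G z -> disc z0 rho z by case: eG => _ GU _ _ /GU[].
pose Psi (x : R[i]) := shrunk_calculus z0 A G (derive1n N H) x.
have [p [h [hs fE]]] := char_poly_interpolation hA fs.
have [a [b ab]] := spectrum_coprime_inverse hv.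
have fAE : fA = horner_mx A p by exact: (matfun_smooth hrho hA hs fE).
have rAE : rA = horner_mx A (u * a) by exact: (matfun_rational u v0 hv ab).
have vAE : vA = horner_mx A v by exact: matfun_poly.
(* By a v + b chi = 1 and Cayley-Hamilton, a(A) is the inverse of v(A). *)
pose W := horner_mx A a.
have Wv : W *m vA = 1%:M.
  have := congr1 (horner_mx A) ab.
  by rewrite rmorphD !rmorphM /= Cayley_Hamilton mulr0 addr0 rmorph1 vAE.
have WE : invmx vA = W.
  have [_ vU] := mulmx1_unit Wv.
  by rewrite -[LHS]mul1mx -Wv mulmxK.
have WX k : W *m (A - z0%:M) ^+ k = (A - z0%:M) ^+ k *m W.
  have -> : (A - z0%:M) ^+ k = horner_mx A (('X - z0%:P) ^+ k).
    by rewrite rmorphXn rmorphB /= horner_mx_X horner_mx_C.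
  by rewrite /W -[LHS]rmorphM -[RHS]rmorphM mulrC.
pose Q (t : R) := (A - z0%:M) ^+ N *m W *m ((N`!%:R)^-1 *: Psi t%:C).
have phiE t : 0 <= t <= 1 -> phi t = nrm (Q t).
  move=> t01; rewrite /phi WE /Q; congr (nrm (_ *m (_ *: _))).
  have FNs := smooth_derive1n N oU Fs.
  rewrite -[_ + _]/(shrink_mx z0 A t) (shrunk_calculusE hrho hA eG t01 FNs).
  rewrite /Psi /shrunk_calculus /resolvent_integral; congr (_ *: _).
  apply/matrixP => i j; rewrite !mxE; apply: eq_contour_integral => z /GU Uz.
  by rewrite HN//; exact: shrink_disc.
have Qc (t : R) : 0 <= t <= 1 -> forall i k,
    tends (nbhs t) (fun s => Q s i k) (Q t i k).
  move=> t01 i k; have HNs := smooth_derive1n N oU Hs.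
  have dPsi i k := shrunk_calculus_deriv hrho hA eG i k t01 HNs.
  have Qx s : Q s = ((A - z0%:M) ^+ N *m W *m (N`!%:R)^-1%:M) *m Psi s%:C.
    by rewrite /Q -[RHS]mulmxA mul_scalar_mx.
  have := mulmx_deriv ((A - z0%:M) ^+ N *m W *m (N`!%:R)^-1%:M) dPsi i k.
  move=> /(slope_continuous (@tends_id R _)) c.
  rewrite Qx (_ : (fun s => Q s i k) = fun s : R =>
    (((A - z0%:M) ^+ N *m W *m (N`!%:R)^-1%:M) *m Psi s%:C) i k); last first.
    by apply/funext => s; rewrite Qx.
  have rc : (real_complex R) x @[x --> t] --> t%:C.
    by apply/tendsP; exact: tends_real_complex.
  exact: (tends_comp (nbhs_filter t) rc c).
have [t0 t001 t0max] := nrm_max01 hnrm Qc.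
exists t0; [exact: t001|split].
  by move=> t t01; rewrite (phiE t t01) (phiE t0 t001); exact: t0max.
rewrite (phiE t0 t001).
pose Y (x : R[i]) := W *m taylor_mx z0 A G H N x.
have NE : N = (L + M).+1 by rewrite /N addn1.
have Y0 : Y 0 = 0 by rewrite /Y taylor_mx0// mulmx0.
(* The decomposition f = p + chi h gives v f - u = (v p - u) + chi (v h),
   hence Y(1) = W (v(A) p(A) - u(A)) = f(A) - r(A). *)
have Y1 : Y 1 = fA - rA.
  rewrite /Y NE taylor_mx1 /shrunk_calculus.
  rewrite (@resolvent_integral_smooth _ _ _ _ hrho A G _
    (fun z => v.[z] * h z) (v * p - u) eG (smoothM vs hs)).
    rewrite rmorphB rmorphM /= mulmxBr -[_ * _]/(_ *m _) mulmxA.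
    rewrite -vAE Wv mul1mx fAE rAE; congr (_ - _).
    by rewrite /W -[LHS]rmorphM mulrC.
  move=> z Uz; have -> : shrink z0 1 z = z by rewrite /shrink mul1r addrC subrK.
  rewrite /H /F fE// hornerD hornerN hornerM.
  by ring.
rewrite -Y1 -[Y 1]subr0 -Y0.
apply: (nrm_mean_value hnrm (Q := Q) (m := L + M)) => [t t01 i k|]; last exact: t0max.
have := mulmx_deriv W (taylor_mx_deriv hrho hA eG (L + M) t01 Hs) i k.
rewrite /Y NE; apply: slope_eq; congr (fun_of_matrix _ i k).
rewrite /Q /Psi NE; move: (shrunk_calculus _ _ _ _ _) => P.
rewrite -!scalemxAr !mulmxA WX scalerA; congr (_ *: _).
rewrite factS natrM.
have f0 : ((L + M)`!%:R : R[i]) != 0 by rewrite pnatr_eq0 -lt0n fact_gt0.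
have n0 : ((L + M).+1%:R : R[i]) != 0 by rewrite pnatr_eq0.
move: f0 n0; move: ((L + M).+1%:R : R[i]) ((L + M)`!%:R : R[i]) => c d d0 c0.
by field; rewrite d0 c0.
Qed.
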